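(* There exists an LP rounding based randomized algorithm that gives an $O\big(\frac{\log\log m_1}{\log m_1}\frac{\log\log m_2}{\log m_2}\big)$-approximation to the packing disjoint bilinear program $$z_{\mathrm{PDB}}=\max_{\mathbf x,\mathbf y}\{\mathbf x^T\mathbf y\mid \mathbf x\in\mathcal X,\ \mathbf y\in\mathcal Y\},$$ where $\mathcal X$ and $\mathcal Y$ are packing polytopes given by $m_1$ and $m_2$ packing constraints respectively.
   Context: The packing polytopes are $\mathcal X=\{\mathbf x\ge\mathbf 0\mid \mathbf P\mathbf x\le\mathbf p\}$ and $\mathcal Y=\{\mathbf y\ge\mathbf 0\mid\mathbf Q\mathbf y\le\mathbf q\}$ in $\mathbb R^n$, where $\mathbf P\in\mathbb R_+^{m_1\times n}$, $\mathbf Q\in\mathbb R_+^{m_2\times n}$, $\mathbf p\in\mathbb R_+^{m_1}$ and $\mathbf q\in\mathbb R_+^{m_2}$ (all entries nonnegative). For this maximization problem, the approximation factor is the fraction of the optimal value $z_{\mathrm{PDB}}$ achieved: an $O(f)$-approximation with $f<1$ means a feasible solution whose objective value is at least a constant times $f\cdot z_{\mathrm{PDB}}$. *)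

(* Defs.v *)
From HB Require Import structures.
From mathcomp Require Import all_boot all_order all_algebra.
From mathcomp Require Import all_classical all_reals all_analysis.

Set Implicit Arguments.
Unset Strict Implicit.
Unset Printing Implicit Defensive.

Import Order.TTheory GRing.Theory Num.Theory.
Local Open Scope classical_set_scope.
Local Open Scope ring_scope.

Section Programs.
Variable R : realType.

Definition nonneg_mx m n (A : 'M[R]_(m, n)) : Prop := forall i j, 0 <= A i j.

Definition le_mx m n (A B : 'M[R]_(m, n)) : Prop := forall i j, A i j <= B i j.

Definition dot n (u v : 'cV[R]_n) : R := (u^T *m v) 0 0.

(* The packing polytope {x >= 0 | P x <= p}; it is also the feasible region of
   a linear program in the form  max {c^T w | A w <= b, w >= 0}. *)
Definition packing m n (P : 'M[R]_(m, n)) (p : 'cV[R]_m) : set 'cV[R]_n :=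
  [set x | nonneg_mx x /\ le_mx (P *m x) p].

Definition lp_optimal k l (A : 'M[R]_(k, l)) (b : 'cV[R]_k) (c w : 'cV[R]_l) :
    Prop :=
  packing A b w /\ forall w', packing A b w' -> dot c w' <= dot c w.

Definition pdb_values m1 m2 n (P : 'M[R]_(m1, n)) (p : 'cV[R]_m1)
    (Q : 'M[R]_(m2, n)) (q : 'cV[R]_m2) : set R :=
  [set v | exists x y, [/\ packing P p x, packing Q q y & v = dot x y]].

(* z = z_PDB, the maximum of x^T y; the maximum exists whenever the two
   polyhedra are nonempty and bounded. *)
Definition is_zPDB m1 m2 n (P : 'M[R]_(m1, n)) (p : 'cV[R]_m1)
    (Q : 'M[R]_(m2, n)) (q : 'cV[R]_m2) (z : R) : Prop :=
  pdb_values P p Q q z /\ ubound (pdb_values P p Q q) z.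

(* log log m / log m. It is positive for m >= 3; for m <= 2 the expression is
   negative or undefined, and the factor is taken to be a constant. *)
Definition loglog_over_log (m : nat) : R :=
  if (m <= 2)%N then 1 else ln (ln m%:R) / ln m%:R.

(* Finitely supported distributions, as lists of weighted outcomes. *)
Definition dist (A : Type) : Type := seq (R * A).

Definition dret A (a : A) : dist A := [:: (1, a)].

Definition dbind A B (d : dist A) (f : A -> dist B) : dist B :=
  [seq (u.1 * v.1, v.2) | u <- d, v <- f u.2].

Definition pr A (d : dist A) (E : A -> Prop) : R :=
  \sum_(u <- d | `[< E u.2 >]) u.1.

End Programs.

(* A randomized real RAM with unit-cost exact arithmetic. A program is a finite
   piece of syntax, independent of the instance and of its dimensions, and its
   only constants are natural numbers. There are natural-number registers,
   which hold loop counters and array indices, and two-dimensional arrays of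
   reals, both named by natural numbers. All loops are bounded, so that every
   program terminates. *)
Inductive nexp : Type :=
| NLit of nat
| NReg of nat
| NAdd of nexp & nexp.

Inductive rexp : Type :=
| RLit of nat
| RGet of nat & nexp & nexp
| RAdd of rexp & rexp
| RSub of rexp & rexp
| RMul of rexp & rexp
| RDiv of rexp & rexp.

Inductive bexp : Type :=
| BNatLe of nexp & nexp
| BRealLe of rexp & rexp.

(* [For v e body] runs body with register v equal to 0, 1, ..., e - 1, where e
   is evaluated once, on entry. [Flip a i j e] sets a[i, j] to 1 with
   probability e (truncated to [0, 1]) and to 0 otherwise, independently of the
   previous draws. *)
Inductive cmd : Type :=
| Skip
| NSet of nat & nexp
| RSet of nat & nexp & nexp & rexp
| Flip of nat & nexp & nexp & rexp
| Seq of cmd & cmd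
| If of bexp & cmd & cmd
| For of nat & nexp & cmd.

Section Semantics.
Variable R : realType.

(* [steps] is the running time so far: the number of elementary commands, tests
   and loop iterations executed. *)
Record state : Type := State {
  reg : nat -> nat;
  arr : nat -> nat -> nat -> R;
  steps : nat }.

Definition charge (t : nat) (s : state) : state :=
  State (reg s) (arr s) (steps s + t)%N.

Definition set_reg (v k : nat) (s : state) : state :=
  State (fun v' => if v' == v then k else reg s v') (arr s) (steps s).

Definition set_arr (a : nat) (F : nat -> nat -> R) (s : state) : state :=
  State (reg s) (fun a' => if a' == a then F else arr s a') (steps s).

Definition set_cell (a i j : nat) (r : R) (s : state) : state :=
  set_arr a (fun i' j' => if (i' == i) && (j' == j) then r else arr s a i' j') s.

Fixpoint neval (e : nexp) (s : state) : nat :=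
  match e with
  | NLit k => k
  | NReg v => reg s v
  | NAdd e1 e2 => (neval e1 s + neval e2 s)%N
  end.

Fixpoint reval (e : rexp) (s : state) : R :=
  match e with
  | RLit k => k%:R
  | RGet a i j => arr s a (neval i s) (neval j s)
  | RAdd e1 e2 => reval e1 s + reval e2 s
  | RSub e1 e2 => reval e1 s - reval e2 s
  | RMul e1 e2 => reval e1 s * reval e2 s
  | RDiv e1 e2 => reval e1 s / reval e2 s
  end.

Definition beval (e : bexp) (s : state) : bool :=
  match e with
  | BNatLe e1 e2 => (neval e1 s <= neval e2 s)%N
  | BRealLe e1 e2 => reval e1 s <= reval e2 s
  end.

Definition clamp01 (r : R) : R := Num.min 1 (Num.max 0 r).

Fixpoint exec (c : cmd) (s : state) : dist R state :=
  match c with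
  | Skip => dret R (charge 1 s)
  | NSet v e => dret R (charge 1 (set_reg v (neval e s) s))
  | RSet a i j e =>
      dret R (charge 1 (set_cell a (neval i s) (neval j s) (reval e s) s))
  | Flip a i j e =>
      let t := clamp01 (reval e s) in
      [:: (t, charge 1 (set_cell a (neval i s) (neval j s) 1 s));
          (1 - t, charge 1 (set_cell a (neval i s) (neval j s) 0 s))]
  | Seq c1 c2 => dbind (exec c1 s) (exec c2)
  | If e c1 c2 => exec (if beval e s then c1 else c2) (charge 1 s)
  | For v e body =>
      iteri (neval e s)
        (fun i d => dbind d (fun s' => exec body (charge 1 (set_reg v i s'))))
        (dret R (charge 1 s))
  end.

Definition mem_of_mx m n (A : 'M[R]_(m, n)) (i j : nat) : R :=
  match insub i, insub j with
  | Some i', Some j' => A i' j'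
  | _, _ => 0
  end.

Definition mx_of_mem m n (F : nat -> nat -> R) : 'M[R]_(m, n) :=
  \matrix_(i < m, j < n) F i j.

(* An LP-rounding algorithm consists of two programs: [build] writes down a
   linear program, an external solver returns an optimal solution of it, and
   [round] turns that solution into the output. Vectors are stored in column 0
   of an array. The calling conventions are:
     input    registers 0, 1, 2 = m1, m2, n;  arrays 0, 1, 2, 3 = P, p, Q, q
     LP       registers 3, 4 = number k of rows, number l of variables;
              arrays 4, 5, 6 = A, b, c  for  max {c^T w | A w <= b, w >= 0}
     solution array 7 = w
     output   arrays 8, 9 = x, y *)
Record lp_rounding_alg : Type := LPRoundingAlg { build : cmd; round : cmd }.

Definition input_state m1 m2 n (P : 'M[R]_(m1, n)) (p : 'cV[R]_m1)
    (Q : 'M[R]_(m2, n)) (q : 'cV[R]_m2) : state :=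
  State (nth 0%N [:: m1; m2; n])
    (nth (fun _ _ => 0)
       [:: mem_of_mx P; mem_of_mx p; mem_of_mx Q; mem_of_mx q])
    0.

Definition lp_rows (s : state) : nat := reg s 3.
Definition lp_vars (s : state) : nat := reg s 4.
Definition lp_A (s : state) : 'M[R]_(lp_rows s, lp_vars s) :=
  mx_of_mem _ _ (arr s 4).
Definition lp_b (s : state) : 'cV[R]_(lp_rows s) := mx_of_mem _ _ (arr s 5).
Definition lp_c (s : state) : 'cV[R]_(lp_vars s) := mx_of_mem _ _ (arr s 6).

(* A call to the solver is charged the size of the linear program. *)
Definition return_solution (s : state) (w : 'cV[R]_(lp_vars s)) : state :=
  charge ((lp_rows s).+1 * (lp_vars s).+1) (set_arr 7 (mem_of_mx w) s).

Definition out_x n (s : state) : 'cV[R]_n := mx_of_mem n 1 (arr s 8).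
Definition out_y n (s : state) : 'cV[R]_n := mx_of_mem n 1 (arr s 9).

(* On the instance (P, p, Q, q) with optimal value z: [build] is deterministic
   and produces a solvable linear program whose optimal value is at least z (an
   LP relaxation). Whichever optimal solution w the solver returns, [round] on w
   almost surely outputs a feasible pair (x, y), with total running time at
   most T, and x^T y >= alpha * z with probability at least 1/2. *)
Definition lp_rounding_approx (alg : lp_rounding_alg) m1 m2 n
    (P : 'M[R]_(m1, n)) (p : 'cV[R]_m1) (Q : 'M[R]_(m2, n)) (q : 'cV[R]_m2)
    (z alpha : R) (T : nat) : Prop :=
  exists s : state,
    [/\ exec (build alg) (input_state P p Q q) = dret R s,
        exists w, lp_optimal (lp_A s) (lp_b s) (lp_c s) w &
        forall w, lp_optimal (lp_A s) (lp_b s) (lp_c s) w ->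
          let D := exec (round alg) (return_solution w) in
          [/\ z <= dot (lp_c s) w,
              pr D (fun s' => packing P p (out_x n s') /\
                              packing Q q (out_y n s')) = 1,
              pr D (fun s' => (steps s' <= T)%N) = 1 &
              2^-1 <= pr D (fun s' =>
                        alpha * z <= dot (out_x n s') (out_y n s'))]].

End Semantics.

(* Main.v *)
Require Import Defs.
From HB Require Import structures.
From mathcomp Require Import all_boot all_order all_algebra.
From mathcomp Require Import all_classical all_reals all_analysis.
From mathcomp Require Import ring lra zify.

(* Let theta_i and gamma_i be the largest values of x_i and y_i on the two
   polytopes, and rescale the constraints to a_ji = P_ji theta_i / p_j and
   b_ji = Q_ji gamma_i / q_j, which lie in [0, 1]. For feasible (x, y), the
   vector w_i = x_i y_i / (theta_i gamma_i) satisfies a w <= 1, b w <= 1 and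
   w <= 1, so the LP maximizing sum_i theta_i gamma_i w_i over these
   constraints is a relaxation.

   An optimal w is rounded to v in {0, 1}^n. Independent rounding is
   derandomized by conditional expectations: with S(v) the LP objective and
   F_a(v) = 1 + sum_j prod_i (1 + t a_ji v_i), where t is about log m1 (and
   similarly F_b, with m2), the potential
     S(v) - S(w)/4 (F_a(v)/F_a(w) + F_b(v)/F_b(w))
   is affine in each coordinate, so every coordinate can be set to 0 or 1
   without decreasing it. For the result, r = S(v)/S(w) >= 1/2 and
   F_a(v) <= 4 r F_a(w) <= 4 r (2 e)^t, while a load (a v)_j = V forces
   F_a(v) >= (1 + t)^V. Hence all loads are at most
   V_a = O(log m1 / log log m1) (1 + ln (4 r)), and
   x = theta v / V_a, y = gamma v / V_b are feasible with
   x^T y = r S(w) / (V_a V_b), where (1 + ln (4 r))^2 = O(r). *)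

Set Implicit Arguments.
Unset Strict Implicit.
Unset Printing Implicit Defensive.

Import Order.TTheory GRing.Theory Num.Theory.
Import numFieldNormedType.Exports.
Local Open Scope classical_set_scope.
Local Open Scope ring_scope.

(** * Existence of optimal solutions of bounded linear programs *)

Lemma lin_continuous (R : realType) n (c : 'I_n -> R) :
  continuous (fun r : 'rV[R]_n => \sum_(i < n) c i * r 0 i).
Proof.
have addc : continuous (fun x : R * R => x.1 + x.2) by exact: add_continuous.
apply: (continuous_big addc) => i _ r.
apply: (@continuous_comp 'rV[R]_n R R (fun r => r 0 i) (fun x => c i * x)).
  exact: coord_continuous.
exact: mulrl_continuous.
Qed.

(** The point 0 is feasible because [b >= 0], and the feasible set is closed inside the unit cube,
    hence compact, so the extreme value theorem applies. Vectors are transposed because the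
    topological results concern row vectors. *)
Lemma bounded_lp_solvable (R : realType) k l (A : 'M[R]_(k, l)) (b : 'cV[R]_k)
    (c : 'cV[R]_l) :
  nonneg_mx b -> (forall w, packing A b w -> forall i, w i 0 <= 1) ->
  exists w, lp_optimal A b c w.
Proof.
move=> b0 bnd.
pose S := [set r : 'rV[R]_l | packing A b r^T].
have S0 : S !=set0.
  exists 0; split; first by move=> i j; rewrite !mxE.
  by rewrite trmx0 mulmx0 => i j; rewrite mxE.
have clS : closed S.
  (* One closed half-space for each inequality. *)
  have -> : S = \bigcap_(i in [set: 'I_l]) [set r : 'rV[R]_l | 0 <= r 0 i] `&`
      \bigcap_(j in [set: 'I_k])
        [set r : 'rV[R]_l | \sum_(i < l) A j i * r 0 i <= b j 0].
    apply/seteqP; split=> r /=.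
      case=> r0 rb; split=> i _ /=; first by have := r0 i 0; rewrite mxE.
      have := rb i 0; rewrite mxE; apply: le_trans; rewrite le_eqVlt; apply/orP; left.
      by apply/eqP/eq_bigr => j _; rewrite mxE.
    case=> r0 rb; split=> i j; rewrite (ord1 j) !mxE; first exact: r0.
    apply: le_trans (rb i I); rewrite le_eqVlt; apply/orP; left.
    by apply/eqP/eq_bigr => j' _; rewrite mxE.
  apply: closedI; apply: closed_bigI => i _.
    apply: (@closed_comp _ _ (fun r : 'rV[R]_l => r 0 i) [set x | 0 <= x]).
      by move=> r _; exact: coord_continuous.
    exact: closed_ge.
  apply: (@closed_comp _ _ (fun r : 'rV[R]_l => \sum_(j < l) A i j * r 0 j)
            [set x | x <= b i 0]).
    by move=> r _; exact: (@lin_continuous R l (A i)).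
  exact: closed_le.
have cS : compact S.
  have c01 : compact [set r : 'rV[R]_l | forall i, `[0, 1]%classic (r 0 i)].
    by apply: (@rV_compact R l (fun=> `[0, 1]%classic)) => _; exact: segment_compact.
  apply: (subclosed_compact clS c01).
  move=> r Sr i /=; rewrite in_itv /=; apply/andP; split.
    by have := Sr.1 i 0; rewrite mxE.
  by have := bnd _ Sr i; rewrite mxE.
have cont : {within S, continuous (fun r : 'rV[R]_l => \sum_(i < l) c i 0 * r 0 i)}.
  exact/continuous_subspaceT/lin_continuous.
have dotE r : dot c r^T = \sum_(i < l) c i 0 * r 0 i.
  by rewrite /dot mxE; apply: eq_bigr => i _; rewrite !mxE.
have [r rS rmax] := EVT_max_rV S0 cS cont.
exists r^T; split; first exact: set_mem.
move=> w wS; rewrite -(trmxK w) !dotE; apply: rmax.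
by apply/mem_set; rewrite /S /= trmxK.
Qed.

(** * Rounding by conditional expectations *)

Section Potential.
Variables (R : realType) (n : nat).
Implicit Types (v c : nat -> R) (A : nat -> nat -> R).

Definition upd v (k : nat) (r : R) (i : nat) : R := if i == k then r else v i.

(** With [v k] read as a probability, the right-hand side is the expectation of [f] after rounding
    coordinate [k]. *)
Definition affine_at (f : (nat -> R) -> R) (k : nat) : Prop :=
  forall v, f v = v k * f (upd v k 1) + (1 - v k) * f (upd v k 0).

Definition linval c v : R := \sum_(i < n) c i * v i.

(** A multilinear stand-in for the exponential moments [(1 + t) ^ load]: its value at a fractional
    point is its expectation under independent rounding. The leading 1 keeps it positive even when
    [m = 0], so that it may be divided by. *)
Definition penalty (t : R) m A v : R :=
  1 + \sum_(j < m) \prod_(i < n) (1 + t * A j i * v i).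

(** [L], [F1], [F2] are to be the values at the fractional solution, where the potential then equals
    [L / 2]. *)
Definition potential t1 m1 A1 t2 m2 A2 c L F1 F2 v : R :=
  linval c v -
  L / 4%:R * (penalty t1 m1 A1 v / F1 + penalty t2 m2 A2 v / F2).

Lemma linval_affine c k : affine_at (linval c) k.
Proof.
move=> v; rewrite /linval !mulr_sumr -big_split /=; apply: eq_bigr => i _.
by rewrite /upd; case: eqP => [->|_]; ring.
Qed.

(** In each product, coordinate [k] occurs in a single factor if [k < n], and in none otherwise. *)
Lemma penalty_affine t m A k : affine_at (penalty t m A) k.
Proof.
move=> v; rewrite /penalty.
suff H j : \prod_(i < n) (1 + t * A j i * v i) =
    v k * (\prod_(i < n) (1 + t * A j i * upd v k 1 i)) +
    (1 - v k) * (\prod_(i < n) (1 + t * A j i * upd v k 0 i)).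
  under eq_bigr => j _ do rewrite H.
  by rewrite big_split /= -!mulr_sumr; ring.
have [kn|nk] := ltnP k n.
  have E r : \prod_(i < n) (1 + t * A j i * upd v k r i) = (1 + t * A j k * r) *
      \prod_(i < n | i != Ordinal kn) (1 + t * A j i * v i).
    rewrite (bigD1 (Ordinal kn)) //= {1}/upd eqxx; congr (_ * _).
    by apply: eq_bigr => i /negbTE; rewrite -val_eqE /upd /= => ->.
  by rewrite !E (bigD1 (Ordinal kn)) //=; ring.
have E r : \prod_(i < n) (1 + t * A j i * upd v k r i) =
    \prod_(i < n) (1 + t * A j i * v i).
  by apply: eq_bigr => i _; rewrite /upd ltn_eqF // (leq_trans (ltn_ord i)).
by rewrite !E; ring.
Qed.

Lemma potential_affine t1 m1 A1 t2 m2 A2 c L F1 F2 k :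
  affine_at (potential t1 m1 A1 t2 m2 A2 c L F1 F2) k.
Proof.
move=> v; rewrite /potential {1}(linval_affine c k v).
rewrite {1}(penalty_affine t1 m1 A1 k v) {1}(penalty_affine t2 m2 A2 k v).
by ring.
Qed.

(** A convex combination is at most the larger of its two ends. The [if] mirrors the test made by
    [fix_prog]. *)
Lemma affine_at_le (f : (nat -> R) -> R) k v :
  affine_at f k -> 0 <= v k <= 1 ->
  f v <= (if f (upd v k 0) <= f (upd v k 1) then f (upd v k 1)
          else f (upd v k 0)).
Proof.
move=> fa /andP[v0 v1]; rewrite (fa v).
set a := f (upd v k 1); set b := f (upd v k 0); case: (lerP b a) => h.
  have : 0 <= (1 - v k) * (a - b) by rewrite mulr_ge0 ?subr_ge0.
  by lra.
have : 0 <= v k * (b - a) by rewrite mulr_ge0 ?subr_ge0 // ltW.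
by lra.
Qed.

Lemma penalty_ge1 t m A v : 0 <= t ->
  (forall j i, (j < m)%N -> (i < n)%N -> 0 <= A j i) ->
  (forall i, (i < n)%N -> 0 <= v i) -> 1 <= penalty t m A v.
Proof.
move=> t0 A0 v0; rewrite lerDl sumr_ge0 // => j _; apply: prodr_ge0 => i _.
by rewrite addr_ge0 // !mulr_ge0 ?A0 ?v0.
Qed.

(** By [1 + x <= e ^ x] in every factor, each product is at most [e ^ (t * load) <= e ^ t]; the
    leading 1 accounts for one more [e ^ t]. *)
Lemma penalty_le t m A v : 0 <= t ->
  (forall j i, (j < m)%N -> (i < n)%N -> 0 <= A j i) ->
  (forall i, (i < n)%N -> 0 <= v i) ->
  (forall j, (j < m)%N -> \sum_(i < n) A j i * v i <= 1) ->
  penalty t m A v <= m.+1%:R * expR t.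
Proof.
move=> t0 A0 v0 Av; rewrite mulrSr mulrDl mul1r [X in _ <= X]addrC lerD //.
  by rewrite -expR0 ler_expR.
rewrite -[X in X%:R](card_ord m) mulr_natl -sumr_const; apply: ler_sum => j _.
apply: (@le_trans _ _ (\prod_(i < n) expR (t * (A j i * v i)))).
  apply: ler_prod => i _; rewrite mulrA expR_ge1Dx andbT.
  by rewrite addr_ge0 // !mulr_ge0 ?A0 ?v0.
by rewrite -expR_sum ler_expR -mulr_sumr ler_piMr // Av.
Qed.

(** Concavity of [ln] between 1 and [1 + t]. *)
Lemma ln1DM_ge (t a : R) : 0 <= t -> 0 <= a <= 1 ->
  a * ln (1 + t) <= ln (1 + t * a).
Proof.
move=> t0 /andP[a0 a1].
have t1 : 0 < 1 + t :> R^o by rewrite ltr_wpDr.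
have := concave_ln (@Itv01 R a a0 a1) t1 (ltr01 : 0 < 1 :> R^o).
rewrite !convRE /= ln1 mulr0 addr0.
suff -> : a * (1 + t) + (1 - a) * 1 = 1 + t * a by [].
by ring.
Qed.

(** Keep only the product of row [j]; by [ln1DM_ge], each of its factors contributes at least its
    share of the load times [ln (1 + t)]. *)
Lemma penalty_ge_exp t m A v j : 0 <= t ->
  (forall j i, (j < m)%N -> (i < n)%N -> 0 <= A j i <= 1) ->
  (forall i, (i < n)%N -> 0 <= v i <= 1) -> (j < m)%N ->
  (\sum_(i < n) A j i * v i) * ln (1 + t) <= ln (penalty t m A v).
Proof.
move=> t0 A01 v01 jm.
have p1 (i : 'I_n) (j' : 'I_m) : 1 <= 1 + t * A j' i * v i.
  have /andP[? _] := A01 _ _ (ltn_ord j') (ltn_ord i).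
  by have /andP[? _] := v01 _ (ltn_ord i); rewrite lerDl !mulr_ge0.
have P1 (j' : 'I_m) : 1 <= \prod_(i < n) (1 + t * A j' i * v i).
  by elim/big_ind : _ => // x y x1 y1; exact: mulr_ege1.
apply: (@le_trans _ _ (ln (\prod_(i < n) (1 + t * A j i * v i)))); last first.
  have Pj := P1 (Ordinal jm).
  rewrite ler_ln ?posrE ?(lt_le_trans ltr01) //; last first.
    by rewrite lerDl sumr_ge0 // => k _; rewrite (le_trans _ (P1 k)).
  rewrite /penalty (bigD1 (Ordinal jm)) //= addrCA lerDl addr_ge0 //.
  by apply: sumr_ge0 => k _; rewrite (le_trans _ (P1 k)).
rewrite mulr_suml.
(* The lower bound 1 on the partial products travels with the induction because [lnM] needs
   positivity. *)
suff H : forall k, (k <= n)%N -> 1 <= \prod_(i < k) (1 + t * A j i * v i) /\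
   \sum_(i < k) A j i * v i * ln (1 + t) <= ln (\prod_(i < k) (1 + t * A j i * v i)).
  exact: (H n (leqnn n)).2.
elim=> [|k IH] kn; first by rewrite !big_ord0 ln1.
have [IH1 IH2] := IH (ltnW kn).
have /= p := p1 (Ordinal kn) (Ordinal jm).
rewrite !big_ord_recr /=; split; first exact: mulr_ege1.
rewrite lnM ?posrE ?(lt_le_trans ltr01) // lerD // -mulrA.
rewrite -[t * A j k * v k]mulrA; rewrite ?mulrA -[t * A j k * v k]mulrA.
apply: ln1DM_ge => //.
have /andP[a0 a1] := A01 _ _ jm kn; have /andP[b0 b1] := v01 _ kn.
by rewrite mulr_ge0 //= mulr_ile1.
Qed.

End Potential.

(** * The approximation factor *)

Section Factor.
Variable R : realType.

Lemma ln2_ge : 2^-1 <= ln 2 :> R.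
Proof.
have := @le_ln1Dx R (- 2^-1); rewrite (_ : 1 - 2^-1 = 2^-1); last by lra.
by rewrite lnV ?posrE // lerN2; apply; lra.
Qed.

Lemma ln2_le : ln 2 <= 1 :> R.
Proof. by have := @le_ln1Dx R 1; rewrite -natr1 mulr1n; apply; lra. Qed.

(* [e <= (8/7) ^ 8 < 3], from [e^(-1/8) >= 7/8]. *)
Lemma ln3_ge1 : 1 <= ln 3 :> R.
Proof.
have h : ln (7 / 8) <= - 8^-1 :> R.
  have := @le_ln1Dx R (- 8^-1); rewrite (_ : 1 - 8^-1 = 7 / 8); last by lra.
  by apply; lra.
have -> : (1 : R) = 8 * 8^-1 by lra.
apply: (@le_trans _ _ (8 * (- ln (7 / 8)))).
  by rewrite ler_pM2l // lerNr.
rewrite -lnV ?posrE ?divr_gt0 // mulr_natl -lnXn ?invr_gt0 ?divr_gt0 //.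
rewrite ler_ln ?posrE ?exprn_gt0 ?invr_gt0 ?divr_gt0 // invf_div.
by lra.
Qed.

Lemma ln_ge1 m : (2 < m)%N -> 1 <= ln m%:R :> R.
Proof.
move=> m3; apply: le_trans ln3_ge1 _.
by rewrite ler_ln ?posrE ?ltr0n ?ler_nat //; lia.
Qed.

Lemma loglog_over_log_ge0 m : 0 <= loglog_over_log R m.
Proof.
rewrite /loglog_over_log; case: leqP => // /ln_ge1 l1.
by apply: divr_ge0; [exact: ln_ge0|exact: le_trans ler01 l1].
Qed.

(** [t] is the number of binary digits of [m] (1 for [m = 0]), an integer replacement for the
    logarithm that can be computed by doubling. *)
Definition log_approx (m t : nat) : Prop :=
  [/\ (0 < t)%N, (m < 2 ^ t)%N & (2 ^ t.-1 <= maxn 1 m)%N].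

(** For [m >= 3], [ln m <= t <= 4 * ln m]: the first inequality compares the numerators, the second
    the denominators. For [m <= 2], [t <= 2 <= 4 * ln 2]. *)
Lemma loglog_over_log_le m t : log_approx m t ->
  loglog_over_log R m <= 4 * (ln (1 + t%:R) / t%:R).
Proof.
move=> [t0 mt tm]; have t0R : 0 < t%:R :> R by rewrite ltr0n.
rewrite /loglog_over_log; case: leqP => m2.
  rewrite mulrA ler_pdivlMr // mul1r.
  have t2 : (t <= 2)%N.
    rewrite leqNgt; apply/negP => t2.
    have : (2 ^ 2 <= 2 ^ t.-1)%N by rewrite leq_exp2l //; lia.
    by move: tm; rewrite leq_max; lia.
  apply: (@le_trans _ _ 2); first by rewrite ler_nat.
  apply: (@le_trans _ _ (4 * ln 2)); first by have := ln2_ge; lra.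
  rewrite ler_pM2l // ler_ln ?posrE // ?ltr_wpDr //.
  by rewrite -natr1 addrC lerD2l ler1n.
have m0 : 0 < m%:R :> R by rewrite ltr0n; lia.
have l1 := ln_ge1 m2.
have l0 : 0 < ln m%:R :> R by rewrite (lt_le_trans ltr01).
have lt : ln m%:R <= t%:R :> R.
  apply: (@le_trans _ _ (ln (2 ^+ t))).
    by rewrite ler_ln ?posrE ?exprn_gt0 // -natrX ler_nat ltnW.
  by rewrite lnXn // -[_ *+ t]mulr_natl ler_piMr // ln2_le.
have tl : t%:R <= 4 * ln m%:R :> R.
  have : ln (2 ^+ t.-1) <= ln m%:R :> R.
    rewrite ler_ln ?posrE ?exprn_gt0 // -natrX ler_nat.
    by move: tm; rewrite (maxn_idPr _) //; lia.
  rewrite lnXn // -[_ *+ t.-1]mulr_natl -[X in X%:R <= _](prednK t0) -natr1.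
  have := ln2_ge; have : 0 <= t.-1%:R :> R by []; nra.
have ll0 : 0 <= ln (ln m%:R) :> R by rewrite ln_ge0.
rewrite ler_pdivrMr // mulrA mulrAC ler_pdivlMr //.
have : ln (ln m%:R) <= ln (1 + t%:R) :> R.
  by rewrite ler_ln ?posrE // ?ltr_wpDr // (le_trans lt) // lerDr.
move: (ln (ln _)) ll0 => x x0 xy.
apply: (@le_trans _ _ (ln (1 + t%:R) * (4 * ln m%:R))).
  by apply: ler_pM; rewrite // ltW.
by rewrite le_eqVlt; apply/orP; left; apply/eqP; ring.
Qed.

Section Load.
Variables (n m t : nat) (A : nat -> nat -> R) (w v : nat -> R).
Hypothesis mt : log_approx m t.
Hypothesis A01 : forall j i, (j < m)%N -> (i < n)%N -> 0 <= A j i <= 1.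
Hypothesis w01 : forall i, (i < n)%N -> 0 <= w i <= 1.
Hypothesis v01 : forall i, (i < n)%N -> 0 <= v i <= 1.
Hypothesis Aw : forall j, (j < m)%N -> \sum_(i < n) A j i * w i <= 1.

(** Take logarithms in [(1 + t) ^ V <= F(v) <= 4 r F(w) <= 4 r (m + 1) e ^ t], where
    [m + 1 <= 2 ^ t] and [ln 2 <= 1]. The case [V = 1] is [ln (1 + t) <= t]. *)
Lemma load_le (r V : R) : 2^-1 <= r ->
  penalty n t%:R m A v <= 4 * r * penalty n t%:R m A w ->
  V = 1 \/ (exists2 j, (j < m)%N & V = \sum_(i < n) A j i * v i) ->
  V <= 2 * t%:R / ln (1 + t%:R) * (1 + ln (4 * r)).
Proof.
move=> r2 pr4 VE; have [t0 mt' _] := mt.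
have t1 : 1 <= t%:R :> R by rewrite ler1n.
have A0 j i : (j < m)%N -> (i < n)%N -> 0 <= A j i by move=> /A01 H /H /andP[].
have w0 i : (i < n)%N -> 0 <= w i by move=> /w01 /andP[].
have v0 i : (i < n)%N -> 0 <= v i by move=> /v01 /andP[].
have l0 : 0 < ln (1 + t%:R) :> R by rewrite ln_gt0 // ltrDl (lt_le_trans ltr01).
have lr0 : 0 <= ln (4 * r) by rewrite ln_ge0 //; lra.
(* As [2 * t >= 1], the sum is at most [2 * t * (1 + ln (4 * r))]. *)
suff H : V * ln (1 + t%:R) <= 2 * t%:R + ln (4 * r).
  rewrite mulrAC ler_pdivlMr // (le_trans H) // mulrDr mulr1 lerD2l ler_peMl //.
  by lra.
case: VE => [->|[j jm ->]].
  rewrite mul1r; have := @le_ln1Dx R t%:R; lra.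
apply: le_trans (penalty_ge_exp _ A01 v01 jm) _ => //.
have pv : 1 <= penalty n t%:R m A v by exact: penalty_ge1.
have pw : 1 <= penalty n t%:R m A w by exact: penalty_ge1.
have r0 : 0 < 4 * r by lra.
have pv0 := lt_le_trans ltr01 pv; have pw0 := lt_le_trans ltr01 pw.
apply: (@le_trans _ _ (ln (4 * r * penalty n t%:R m A w))).
  by rewrite ler_ln ?posrE // mulr_gt0.
rewrite lnM ?posrE // addrC lerD2r.
have pm : penalty n t%:R m A w <= 2 ^+ t * expR t%:R.
  apply: le_trans (penalty_le _ _ _ Aw) _ => //.
  by rewrite ler_pM2r ?expR_gt0 // -natrX ler_nat.
have e0 : 0 < (2 ^+ t : R) by rewrite exprn_gt0.
apply: (@le_trans _ _ (ln (2 ^+ t * expR t%:R))).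
  by rewrite ler_ln ?posrE // mulr_gt0 ?expR_gt0.
rewrite lnM ?posrE ?expR_gt0 // expRK lnXn // mulrDl mul1r lerD2r.
by rewrite -[_ *+ t]mulr_natl ler_piMr // ln2_le.
Qed.

End Load.

(** From [ln u = 2 ln (sqrt u) <= 2 (sqrt u - 1)] one gets [1 + ln u <= 2 sqrt u]. *)
Lemma sqr1Dln_le (u : R) : 1 <= u -> (1 + ln u) ^+ 2 <= 4 * u.
Proof.
move=> u1; have u0 : 0 < u by rewrite (lt_le_trans ltr01).
have s0 : 0 < Num.sqrt u by rewrite sqrtr_gt0.
have lu : ln u = 2 * ln (Num.sqrt u).
  by rewrite mulr_natl -lnXn // sqr_sqrtr // ltW.
have h : ln (Num.sqrt u) <= Num.sqrt u - 1.
  by have := @le_ln1Dx R (Num.sqrt u - 1); rewrite [1 + _]addrC subrK; apply; lra.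
have lu0 : 0 <= ln u by rewrite ln_ge0.
apply: (@le_trans _ _ ((2 * Num.sqrt u) ^+ 2)); last first.
  by rewrite exprMn sqr_sqrtr ?(ltW u0) //; lra.
by rewrite ler_sqr ?nnegrE; lra.
Qed.

(* With [r = c.v / c.w], maximality of the potential gives [r >= 1/2] and
   bounds both penalties by [4 r] times their initial values; the load then
   grows by a factor [1 + ln (4 r)] only, whose square is [O(r)]. *)
Lemma rounding_value n m1 m2 t1 t2 (A1 A2 : nat -> nat -> R)
    (c w v : nat -> R) (V1 V2 : R) :
  log_approx m1 t1 -> log_approx m2 t2 ->
  (forall j i, (j < m1)%N -> (i < n)%N -> 0 <= A1 j i <= 1) ->
  (forall j i, (j < m2)%N -> (i < n)%N -> 0 <= A2 j i <= 1) ->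
  (forall i, (i < n)%N -> 0 <= c i) ->
  (forall i, (i < n)%N -> 0 <= w i <= 1) ->
  (forall i, (i < n)%N -> 0 <= v i <= 1) ->
  (forall j, (j < m1)%N -> \sum_(i < n) A1 j i * w i <= 1) ->
  (forall j, (j < m2)%N -> \sum_(i < n) A2 j i * w i <= 1) ->
  (let pot := potential n t1%:R m1 A1 t2%:R m2 A2 c (linval n c w)
                (penalty n t1%:R m1 A1 w) (penalty n t2%:R m2 A2 w) in
   pot w <= pot v) ->
  0 < V1 -> V1 = 1 \/ (exists2 j, (j < m1)%N & V1 = \sum_(i < n) A1 j i * v i) ->
  0 < V2 -> V2 = 1 \/ (exists2 j, (j < m2)%N & V2 = \sum_(i < n) A2 j i * v i) ->
  4^-1 ^+ 5 * (loglog_over_log R m1 * loglog_over_log R m2) * linval n c w <=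
  linval n c v / (V1 * V2).
Proof.
move=> mt1 mt2 A1b A2b c0 wb vb A1w A2w /= pot V1p V1E V2p V2E.
have [t1p _ _] := mt1; have [t2p _ _] := mt2.
have A1p j i : (j < m1)%N -> (i < n)%N -> 0 <= A1 j i by move=> /A1b H /H /andP[].
have A2p j i : (j < m2)%N -> (i < n)%N -> 0 <= A2 j i by move=> /A2b H /H /andP[].
have w0 i : (i < n)%N -> 0 <= w i by move=> /wb /andP[].
have v0 i : (i < n)%N -> 0 <= v i by move=> /vb /andP[].
have pv1 : 1 <= penalty n t1%:R m1 A1 v by exact: penalty_ge1.
have pv2 : 1 <= penalty n t2%:R m2 A2 v by exact: penalty_ge1.
have pw1 : 1 <= penalty n t1%:R m1 A1 w by exact: penalty_ge1.
have pw2 : 1 <= penalty n t2%:R m2 A2 w by exact: penalty_ge1.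
have L0 : 0 <= linval n c w by apply: sumr_ge0 => i _; rewrite mulr_ge0 ?c0 ?w0.
have S0 : 0 <= linval n c v by apply: sumr_ge0 => i _; rewrite mulr_ge0 ?c0 ?v0.
(* The ratio [r] needs a positive denominator; if it is 0, so is the left-hand side of the goal. *)
have [Lz|Lp] : linval n c w = 0 \/ 0 < linval n c w.
  by move: L0; rewrite le_eqVlt => /orP[/eqP <-|]; [left|right].
  by rewrite Lz mulr0 divr_ge0 // mulr_ge0 // ltW.
move: pot; rewrite /potential.
rewrite !divff ?gt_eqF ?(lt_le_trans ltr01) //.
set L := linval n c w in L0 Lp *; set S := linval n c v in S0 *.
set p1 := penalty n _ m1 _ v in pv1 *; set q1 := penalty n _ m1 _ w in pw1 *.
set p2 := penalty n _ m2 _ v in pv2 *; set q2 := penalty n _ m2 _ w in pw2 *.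
move=> pot.
have q1p : 0 < q1 by rewrite (lt_le_trans ltr01).
have q2p : 0 < q2 by rewrite (lt_le_trans ltr01).
pose r := S / L.
have SE : S = r * L by rewrite /r divfK // gt_eqF.
have d1 : 0 < p1 / q1 by rewrite divr_gt0 // (lt_le_trans ltr01).
have d2 : 0 < p2 / q2 by rewrite divr_gt0 // (lt_le_trans ltr01).
(* This is the potential inequality divided by [L]. The three terms on the left are nonnegative, and
   each gives a separate bound. *)
have rb : 2^-1 + 4^-1 * (p1 / q1) + 4^-1 * (p2 / q2) <= r.
  rewrite -(ler_pM2r Lp) -SE; move: pot; set x := p1 / q1; set y := p2 / q2.
  by lra.
have r2 : 2^-1 <= r by lra.
have P1 : p1 <= 4 * r * q1 by rewrite -ler_pdivrMr //; lra.
have P2 : p2 <= 4 * r * q2 by rewrite -ler_pdivrMr //; lra.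
have H1 := load_le mt1 A1b wb vb A1w r2 P1 V1E.
have H2 := load_le mt2 A2b wb vb A2w r2 P2 V2E.
have g1 := loglog_over_log_le mt1; have g2 := loglog_over_log_le mt2.
have g10 := loglog_over_log_ge0 m1; have g20 := loglog_over_log_ge0 m2.
have t1R : 1 <= t1%:R :> R by rewrite ler1n.
have t2R : 1 <= t2%:R :> R by rewrite ler1n.
have l1 : 0 < ln (1 + t1%:R) :> R by rewrite ln_gt0 // ltrDl (lt_le_trans ltr01).
have l2 : 0 < ln (1 + t2%:R) :> R by rewrite ln_gt0 // ltrDl (lt_le_trans ltr01).
have lr := @sqr1Dln_le (4 * r) ltac:(lra).
have lr0 : 0 <= ln (4 * r) by rewrite ln_ge0 //; lra.
move: H1 H2 g1 g2; rewrite -![2 * _ / _]mulrA.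
rewrite -[t1%:R / ln _]invf_div -[t2%:R / ln _]invf_div.
have : 0 < ln (1 + t1%:R) / t1%:R :> R by rewrite divr_gt0 // (lt_le_trans ltr01).
have : 0 < ln (1 + t2%:R) / t2%:R :> R by rewrite divr_gt0 // (lt_le_trans ltr01).
move: (ln (1 + t1%:R) / _) (ln (1 + t2%:R) / _) => a1 a2 a2p a1p H1 H2 g1 g2.
rewrite ler_pdivlMr ?mulr_gt0 // SE.
set h := 1 + ln (4 * r) in lr H1 H2.
have VV : V1 * V2 <= (2 * a1^-1 * h) * (2 * a2^-1 * h).
  by apply: ler_pM => //; rewrite ltW.
have GG : loglog_over_log R m1 * loglog_over_log R m2 <= (4 * a1) * (4 * a2).
  by apply: ler_pM.
move: (loglog_over_log R m1 * _) (mulr_ge0 g10 g20) GG => G G0 GG.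
rewrite mulrAC ler_pM2r //.
(* The constant: [4 * 4] from [loglog_over_log_le], [2 * 2] from [load_le], and [h ^ 2 <= 16 * r]
   make [4 ^ 5] in total. *)
apply: (@le_trans _ _ (4^-1 ^+ 5 * (4 * a1 * (4 * a2)) *
                          (2 * a1^-1 * h * (2 * a2^-1 * h)))); last first.
  rewrite (_ : 4^-1 ^+ 5 * _ * _ = 16^-1 * h ^+ 2); first by lra.
  by field; rewrite !gt_eqF.
have k0 : 0 < 4^-1 ^+ 5 :> R by rewrite exprn_gt0 // invr_gt0.
move: (4^-1 ^+ 5) k0 => k k0.
apply: ler_pM; rewrite ?mulr_ge0 ?(ltW V1p) ?(ltW V2p) ?(ltW k0) //.
by rewrite ler_pM2l.
Qed.

End Factor.

(** * Deterministic programs *)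

Fixpoint flip_free (c : cmd) : bool :=
  match c with
  | Flip _ _ _ _ => false
  | Seq c1 c2 | If _ c1 c2 => flip_free c1 && flip_free c2
  | For _ _ body => flip_free body
  | _ => true
  end.

Fixpoint warr (c : cmd) : seq nat :=
  match c with
  | RSet a _ _ _ | Flip a _ _ _ => [:: a]
  | Seq c1 c2 | If _ c1 c2 => warr c1 ++ warr c2
  | For _ _ body => warr body
  | _ => [::]
  end.

Fixpoint wreg (c : cmd) : seq nat :=
  match c with
  | NSet v _ => [:: v]
  | Seq c1 c2 | If _ c1 c2 => wreg c1 ++ wreg c2
  | For v _ body => v :: wreg body
  | _ => [::]
  end.

(* Every loop bound is one of the registers 0, 1, 2, holding the dimensions. *)
Fixpoint dim_loops (c : cmd) : bool :=
  match c with
  | Seq c1 c2 | If _ c1 c2 => dim_loops c1 && dim_loops c2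
  | For _ (NReg r) body => (r < 3)%N && dim_loops body
  | For _ _ _ => false
  | _ => true
  end.

(* The exponent of a polynomial bound on the running time. *)
Fixpoint tdeg (c : cmd) : nat :=
  match c with
  | Seq c1 c2 | If _ c1 c2 => tdeg c1 + tdeg c2
  | For _ _ body => (tdeg body).+1
  | _ => 1
  end.

(* [charge] also names signed measures in MathComp-Analysis. *)
Local Notation tick := (@Defs.charge _ 1).

Section Run.
Variable R : realType.
Implicit Types (s : state R) (c : cmd).

Fixpoint run c s : state R :=
  match c with
  | Skip => tick s
  | NSet v e => tick (set_reg v (neval e s) s)
  | RSet a i j e =>
      tick (set_cell a (neval i s) (neval j s) (reval e s) s)
  | Flip _ _ _ _ => s
  | Seq c1 c2 => run c2 (run c1 s)
  | If e c1 c2 => run (if beval e s then c1 else c2) (tick s)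
  | For v e body =>
      iteri (neval e s) (fun i s' => run body (tick (set_reg v i s')))
        (tick s)
  end.

Lemma dbind_dret A B (a : A) (f : A -> dist R B) b :
  f a = dret R b -> dbind (dret R a) f = dret R b.
Proof. by rewrite /dbind /dret /= => -> /=; rewrite mulr1. Qed.

(** Without coin flips all distributions are point masses, so everything below can be stated about a
    single final state. *)
Lemma exec_run c s : flip_free c -> exec c s = dret R (run c s).
Proof.
elim: c s => //= [c1 IH1 c2 IH2|e c1 IH1 c2 IH2|v e body IH] s.
- by case/andP=> f1 f2; rewrite IH1 //; apply: dbind_dret; exact: IH2.
- by case/andP=> f1 f2; case: ifP => _; [exact: IH1|exact: IH2].
move=> fb; elim: (neval e s) => //= k ->.
by apply: dbind_dret; exact: IH.
Qed.

Lemma pr_dret A (a : A) (E : A -> Prop) : E a -> pr (dret R a) E = 1.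
Proof. by move=> Ea; rewrite /pr /dret big_cons big_nil /= asboolT // addr0. Qed.

(** Together with the syntactic write sets [warr] and [wreg], this reduces noninterference between
    program fragments to list membership. *)
Definition frame (W V : seq nat) s s' : Prop :=
  (forall a, a \notin W -> arr s' a = arr s a) /\
  (forall v, v \notin V -> reg s' v = reg s v).

Lemma frame_trans W V W' V' s1 s2 s3 :
  frame W V s1 s2 -> frame W' V' s2 s3 -> frame (W ++ W') (V ++ V') s1 s3.
Proof.
move=> [a1 r1] [a2 r2]; split=> k; rewrite mem_cat negb_or => /andP[k1 k2].
  by rewrite a2 ?a1.
by rewrite r2 ?r1.
Qed.

Lemma frame_iter body v k s :
  (forall s', frame (warr body) (wreg body) s' (run body s')) ->
  frame (warr body) (v :: wreg body) s
    (iteri k (fun i s' => run body (tick (set_reg v i s'))) (tick s)).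
Proof.
move=> IH; elim: k => [|k [IHa IHr]] //=.
have [a1 r1] := IH (tick (set_reg v k
  (iteri k (fun i s' => run body (tick (set_reg v i s'))) (tick s)))).
split=> x; first by move=> xW; rewrite a1 //= IHa.
by rewrite inE negb_or => /andP[xv xV]; rewrite r1 //= (negbTE xv) IHr // inE negb_or xv.
Qed.

Lemma frame_run c s : frame (warr c) (wreg c) s (run c s).
Proof.
elim: c s => //= [v e|a i j e|c1 IH1 c2 IH2|e c1 IH1 c2 IH2|v e body IH] s.
- by split=> // x; rewrite inE /= => /negbTE ->.
- by split=> // x; rewrite inE /= => /negbTE ->.
- exact: frame_trans (IH1 s) (IH2 _).
- case: ifP => _.
    have [a1 r1] := IH1 (tick s).
    by split=> k; rewrite mem_cat negb_or => /andP[k1 k2]; rewrite ?a1 ?r1.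
  have [a1 r1] := IH2 (tick s).
  by split=> k; rewrite mem_cat negb_or => /andP[k1 k2]; rewrite ?a1 ?r1.
- exact: frame_iter.
Qed.

(** The loop rule. The frame is handed to the preservation step, so that an invariant only has to
    mention what the loop changes. *)
Lemma run_for_inv (I : nat -> state R -> Prop) v e body s :
  I 0%N (tick s) ->
  (forall i s', (i < neval e s)%N -> frame (warr body) (v :: wreg body) s s' ->
     I i s' -> I i.+1 (run body (tick (set_reg v i s')))) ->
  I (neval e s) (run (For v e body) s).
Proof.
move=> I0 IS /=; have: (neval e s <= neval e s)%N by [].
elim: {1 3 4}(neval e s) => //= k IH kn.
by apply: IS => //; [exact: frame_iter (frame_run body)|exact: IH (ltnW kn)].
Qed.

Lemma run_fold (g : nat -> R -> R) a v e body s :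
  (forall i s', (i < neval e s)%N -> frame (warr body) (v :: wreg body) s s' ->
     reg s' v = i -> arr (run body s') a 0%N 0%N = g i (arr s' a 0%N 0%N)) ->
  arr (run (For v e body) s) a 0%N 0%N = iteri (neval e s) g (arr s a 0%N 0%N).
Proof.
move=> H; apply: (run_for_inv (I := fun k s' =>
  arr s' a 0%N 0%N = iteri k g (arr s a 0%N 0%N))) => // i s' ie fr IH.
rewrite (H i) //=; [by rewrite IH| |by rewrite eqxx].
case: fr => fa fv; split=> [x|x xV] /=; first exact: fa.
by move: (xV); rewrite inE negb_or => /andP[/negbTE-> _]; rewrite fv.
Qed.

Lemma iteri_sum k (f : nat -> R) r :
  iteri k (fun i x => x + f i) r = r + \sum_(i < k) f i.
Proof.
elim: k => [|k IH]; first by rewrite big_ord0 addr0.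
by rewrite big_ord_recr /= IH addrA.
Qed.

Lemma iteri_prod k (f : nat -> R) r :
  iteri k (fun i x => x * f i) r = r * \prod_(i < k) f i.
Proof.
elim: k => [|k IH]; first by rewrite big_ord0 mulr1.
by rewrite big_ord_recr /= IH mulrA.
Qed.

(** For loops that fill a segment of column 0: distinct iterations write distinct cells. *)
Lemma run_map (f : nat -> R) a b v e body s :
  (forall i s', (i < neval e s)%N -> frame (warr body) (v :: wreg body) s s' ->
     reg s' v = i -> forall x y, arr (run body s') a x y =
       if (x == b + i)%N && (y == 0)%N then f i else arr s' a x y) ->
  forall x y, arr (run (For v e body) s) a x y =
    if (b <= x < b + neval e s)%N && (y == 0)%N then f (x - b)%N
    else arr s a x y.
Proof.
move=> H; apply: (run_for_inv (I := fun k s' => forall x y, arr s' a x y =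
    if (b <= x < b + k)%N && (y == 0)%N then f (x - b)%N else arr s a x y)).
  by move=> x y /=; case: ifP => //; lia.
move=> i s' ie fr IH x y; rewrite (H i) //=.
- rewrite IH; case: (y =P 0%N) => [_|_]; last by rewrite !andbF.
  rewrite !andbT; case: (x =P _) => [->|xi].
    by rewrite leq_addr addKn addnS ltnS leqnn.
  by case: ifP => h1; case: ifP => h2 //; lia.
- case: fr => fa fv; split=> [x'|x' xV] /=; first exact: fa.
  by move: (xV); rewrite inE negb_or => /andP[/negbTE-> _]; rewrite fv.
- by rewrite eqxx.
Qed.

Definition dims_below (N : nat) s : Prop := forall r, (r < 3)%N -> (reg s r <= N)%N.

(** The dimension registers are never written, so every loop runs at most [N] times. With
    [X = N + 2], sequencing uses [X ^ d + X ^ e <= X ^ (d + e)], and a loop uses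
    [1 + N * (X ^ d + 1) <= X ^ (d + 1)]. *)
Lemma run_time c N s : dim_loops c -> flip_free c -> all (leq 3) (wreg c) ->
  dims_below N s -> (steps (run c s) <= steps s + N.+2 ^ tdeg c)%N.
Proof.
have keep c' s' : all (leq 3) (wreg c') -> dims_below N s' ->
    dims_below N (run c' s').
  move=> /allP al ds r r3; have [_ fr] := frame_run c' s'.
  by rewrite fr ?ds //; apply/negP => /al; lia.
have tdeg_gt0 c' : (0 < tdeg c')%N.
  by elim: c' => //= [c1 h1 c2 h2|_ c1 h1 c2 h2]; rewrite addn_gt0 h1.
have expX1 c' : (N.+2 <= N.+2 ^ tdeg c')%N.
  by rewrite -{1}(expn1 N.+2) leq_exp2l.
elim: c s => //= [s _ _ _ _|v e s _ _ _ _|a i j e s _ _ _ _|c1 IH1 c2 IH2 s|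
                  e c1 IH1 c2 IH2 s|v e body IH s].
- by rewrite expn1 leq_add2l.
- by rewrite expn1 leq_add2l.
- by rewrite expn1 leq_add2l.
- rewrite all_cat => /andP[d1 d2] /andP[f1 f2] /andP[w1 w2] ds.
  apply: leq_trans (IH2 _ d2 f2 w2 (keep _ _ w1 ds)) _.
  apply: leq_trans (leq_add (IH1 _ d1 f1 w1 ds) (leqnn _)) _.
  have := expX1 c1; have := expX1 c2; rewrite expnD; nia.
- rewrite all_cat => /andP[d1 d2] /andP[f1 f2] /andP[w1 w2] ds.
  have := expX1 c1; have := expX1 c2; rewrite expnD.
  case: ifP => _ X2 X1.
    by apply: leq_trans (IH1 (tick s) d1 f1 w1 ds) _ => /=; nia.
  by apply: leq_trans (IH2 (tick s) d2 f2 w2 ds) _ => /=; nia.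
case: e => // r /andP[r3 db] fb /andP[v3 wb] ds.
have H k : dims_below N
      (iteri k (fun i s' => run body (tick (set_reg v i s'))) (tick s)) /\
    (steps (iteri k (fun i s' => run body (tick (set_reg v i s'))) (tick s)) <=
     steps s + 1 + k * (N.+2 ^ tdeg body).+1)%N.
  elim: k => [|k [IHd IHs]]; first by split=> //=; rewrite addn0.
  have dk : dims_below N (tick (set_reg v k
      (iteri k (fun i s' => run body (tick (set_reg v i s'))) (tick s)))).
    by move=> x x3 /=; case: eqP => [xv|_]; [lia|exact: IHd].
  split; first exact: keep.
  by rewrite /=; apply: leq_trans (IH _ db fb wb dk) _ => /=; lia.
have [_ /leq_trans] := H (reg s r); apply.
have := expX1 body; have := ds _ r3; rewrite /= expnS; nia.
Qed.

End Run.

(** * The algorithm *)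

Local Notation "c1 ;; c2" := (Seq c1 c2) (at level 95, right associativity).

Definition cell a := RGet a (NLit 0) (NLit 0).
Definition entry a v := RGet a (NReg v) (NLit 0).
Definition put a e := RSet a (NLit 0) (NLit 0) e.

(* Registers 5, 6, 7 are loop counters: 5 for coordinates, 6 for constraints.
   Arrays 11 and 12 hold the coordinate bounds theta and gamma of the two
   polytopes, array 10 the vector being rounded; 13 to 26 are scalars. *)

(* theta_i = max {x_i | x in X}, i.e. the least of the ratios p_j / P_ji with
   P_ji > 0. The sum of all ratios (those with P_ji = 0 being 0) serves as an
   upper bound to start from. *)
Definition bound_prog aM ab rm out : cmd :=
  For 5 (NReg 2)
    (put 13 (RLit 0) ;;
     For 6 (NReg rm)
       (put 13 (RAdd (cell 13)
          (RDiv (entry ab 6) (RGet aM (NReg 6) (NReg 5))))) ;;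
     For 6 (NReg rm)
       (If (BRealLe (RMul (RGet aM (NReg 6) (NReg 5)) (cell 13)) (entry ab 6))
          Skip
          (put 13 (RDiv (entry ab 6) (RGet aM (NReg 6) (NReg 5))))) ;;
     RSet out (NReg 5) (NLit 0) (cell 13)).

(** The matrix of the linear program consists of three blocks: [m1] and [m2] normalized rows, then
    [n] rows for [w_i <= 1]. A zero right-hand side makes its row zero, as [x / 0 = 0]. *)
Definition rows_prog base rm aM ab th : cmd :=
  For 6 (NReg rm) (For 5 (NReg 2)
    (RSet 4 (NAdd base (NReg 6)) (NReg 5)
       (RDiv (RMul (RGet aM (NReg 6) (NReg 5)) (entry th 5)) (entry ab 6)))).

Definition box_prog : cmd :=
  For 5 (NReg 2)
    (RSet 4 (NAdd (NAdd (NReg 0) (NReg 1)) (NReg 5)) (NReg 5) (RLit 1)).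

Definition ones_prog base rm : cmd :=
  For 6 (NReg rm) (RSet 5 (NAdd base (NReg 6)) (NLit 0) (RLit 1)).

Definition obj_prog : cmd :=
  For 5 (NReg 2)
    (RSet 6 (NReg 5) (NLit 0) (RMul (entry 11 5) (entry 12 5))).

Definition build_prog : cmd :=
  bound_prog 0 1 0 11 ;; bound_prog 2 3 1 12 ;;
  rows_prog (NLit 0) 0 0 1 11 ;; rows_prog (NReg 0) 1 2 3 12 ;; box_prog ;;
  ones_prog (NLit 0) 0 ;; ones_prog (NReg 0) 1 ;;
  ones_prog (NAdd (NReg 0) (NReg 1)) 2 ;; obj_prog ;;
  NSet 3 (NAdd (NAdd (NReg 0) (NReg 1)) (NReg 2)) ;; NSet 4 (NReg 2).

Definition copy_prog : cmd :=
  For 5 (NReg 2) (RSet 10 (NReg 5) (NLit 0) (entry 7 5)).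

(** Register 8 holds the power [2 ^ t]. As all loops are bounded, the doubling is tested [m] times
    instead of run until it stops. *)
Definition log_prog rm out : cmd :=
  NSet 8 (NLit 2) ;; put out (RLit 1) ;;
  For 6 (NReg rm)
    (If (BNatLe (NReg 8) (NReg rm))
       (NSet 8 (NAdd (NReg 8) (NReg 8)) ;; put out (RAdd (cell out) (RLit 1)))
       Skip).

Definition linval_prog out : cmd :=
  put out (RLit 0) ;;
  For 5 (NReg 2) (put out (RAdd (cell out) (RMul (entry 6 5) (entry 10 5)))).

Definition penalty_prog base rm tc out : cmd :=
  put out (RLit 1) ;;
  For 6 (NReg rm)
    (put 14 (RLit 1) ;;
     For 5 (NReg 2)
       (put 14 (RMul (cell 14) (RAdd (RLit 1)
          (RMul (RMul (cell tc) (RGet 4 (NAdd base (NReg 6)) (NReg 5)))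
             (entry 10 5))))) ;;
     put out (RAdd (cell out) (cell 14))).

Definition values_prog o o1 o2 : cmd :=
  linval_prog o ;; penalty_prog (NLit 0) 0 15 o1 ;;
  penalty_prog (NReg 0) 1 16 o2.

Definition potential_prog out : cmd :=
  values_prog 17 18 19 ;;
  put out (RSub (cell 17) (RMul (RDiv (cell 20) (RLit 4))
    (RAdd (RDiv (cell 18) (cell 21)) (RDiv (cell 19) (cell 22))))).

(** Cells 23 and 24 receive the potentials for the choices 1 and 0. *)
Definition fix_prog : cmd :=
  For 7 (NReg 2)
    (RSet 10 (NReg 7) (NLit 0) (RLit 1) ;; potential_prog 23 ;;
     RSet 10 (NReg 7) (NLit 0) (RLit 0) ;; potential_prog 24 ;;
     If (BRealLe (cell 24) (cell 23))
       (RSet 10 (NReg 7) (NLit 0) (RLit 1)) Skip).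

(** The maximum starts at 1, so the output is never scaled up and the divisor is positive. *)
Definition load_prog base rm out : cmd :=
  put out (RLit 1) ;;
  For 6 (NReg rm)
    (put 14 (RLit 0) ;;
     For 5 (NReg 2)
       (put 14 (RAdd (cell 14)
          (RMul (RGet 4 (NAdd base (NReg 6)) (NReg 5)) (entry 10 5)))) ;;
     If (BRealLe (cell 14) (cell out)) Skip (put out (cell 14))).

Definition output_prog th ld out : cmd :=
  For 5 (NReg 2)
    (RSet out (NReg 5) (NLit 0)
       (RDiv (RMul (entry th 5) (entry 10 5)) (cell ld))).

(** Cells 20, 21, 22 record the objective and the penalties of the fractional solution before
    [fix_prog] overwrites array 10. *)
Definition round_prog : cmd :=
  copy_prog ;; log_prog 0 15 ;; log_prog 1 16 ;; values_prog 20 21 22 ;;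
  fix_prog ;; load_prog (NLit 0) 0 25 ;; load_prog (NReg 0) 1 26 ;;
  output_prog 11 25 8 ;; output_prog 12 26 9.

Local Ltac notin := by rewrite /= ?inE; lia.

Arguments run : simpl never.

(** * Input-output behaviour of the program fragments *)

Section Specifications.
Variable R : realType.
Implicit Type s : state R.

Lemma run_seq c1 c2 s : run (c1 ;; c2) s = run c2 (run c1 s).
Proof. by []. Qed.

Lemma run_if e c1 c2 s :
  run (If e c1 c2) s = run (if beval e s then c1 else c2) (tick s).
Proof. by []. Qed.

Lemma arr_put a e s : arr (run (put a e) s) a 0%N 0%N = reval e s.
Proof. by rewrite /run /= eqxx. Qed.

Lemma arr_rset a i j e s x y : arr (run (RSet a i j e) s) a x y =
  if (x == neval i s) && (y == neval j s) then reval e s else arr s a x y.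
Proof. by rewrite /run /= eqxx. Qed.

(** If column [i] vanishes the value is 0, since [x / 0 = 0], although the coordinate is then
    unbounded above; [zero_column] deals with this case. *)
Definition coord_bound (M b : nat -> nat -> R) (m i : nat) : R :=
  iteri m (fun j x => if M j i * x <= b j 0%N then x else b j 0%N / M j i)
    (\sum_(j < m) b j 0%N / M j i).

Lemma bound_progE aM ab rm out s i :
  (aM < 10)%N -> (ab < 10)%N -> (rm < 2)%N -> (10 < out < 13)%N ->
  (i < reg s 2)%N ->
  arr (run (bound_prog aM ab rm out) s) out i 0%N =
  coord_bound (arr s aM) (arr s ab) (reg s rm) i.
Proof.
move=> haM hab hrm hout hi.
rewrite (@run_map R (coord_bound (arr s aM) (arr s ab) (reg s rm)) out 0).
  by rewrite /= add0n hi subn0.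
move=> {hi}i s' _ [fa fr] ri x y; rewrite !run_seq arr_rset add0n.
move: (run (put 13 (RLit 0)) s') (frame_run (put 13 (RLit 0)) s')
  (arr_put 13 (RLit 0) s') => s1 [a1 r1] v1.
set s2 := run (For _ _ _) s1; set s3 := run (For _ _ _) s2.
have [a2 r2] : frame _ _ s1 s2 := frame_run _ _.
have [a3 r3] : frame _ _ s2 s3 := frame_run _ _.
have ri1 : reg s1 5 = i by rewrite r1.
have ri2 : reg s2 5 = i by rewrite r2 ?inE.
have v2 : arr s2 13 0%N 0%N = \sum_(j < reg s rm) arr s ab j 0%N / arr s aM j i.
  rewrite /s2 (run_fold (g := fun j x => x + arr s ab j 0%N / arr s aM j i)).
    rewrite iteri_sum v1 /= add0r r1 // fr //; notin.
  move=> j s4 _ [fa4 fr4] rj; rewrite arr_put /= rj.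
  rewrite !(fa4 ab, fa4 aM, a1 ab, a1 aM, fa ab, fa aM); try notin.
  by rewrite fr4 ?inE // ri1.
have v3 : arr s3 13 0%N 0%N = coord_bound (arr s aM) (arr s ab) (reg s rm) i.
  rewrite /s3 (run_fold (g := fun j x =>
    if arr s aM j i * x <= arr s ab j 0%N then x else arr s ab j 0%N / arr s aM j i)).
    by rewrite v2 /coord_bound /= r2 ?r1 ?fr //; notin.
  move=> j s4 _ [fa4 fr4] rj; rewrite run_if /= rj.
  have -> : reg s4 5 = i by rewrite fr4 ?inE // ri2.
  have -> : arr s4 ab = arr s ab by rewrite fa4 ?a2 ?a1 ?fa //; notin.
  have e4 : arr s4 aM = arr s aM by rewrite fa4 ?a2 ?a1 ?fa //; notin.
  rewrite e4; case: ifP => // _; rewrite arr_put /= rj e4.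
  have -> : arr s4 ab = arr s ab by rewrite fa4 ?a2 ?a1 ?fa //; notin.
  by rewrite fr4 ?inE // ri2.
rewrite /= v3 r3 ?inE // ri2.
by rewrite a3 ?a2 ?a1 //; notin.
Qed.

(** The frame hypothesis makes the row offset constant during the loops. The outer invariant
    describes complete rows, the inner one a prefix of row [j]. *)
Lemma rows_progE base rm aM ab th s x y :
  (aM < 4)%N -> (ab < 4)%N -> (rm < 2)%N -> (10 < th)%N ->
  (forall s', frame [:: 4] [:: 6; 5] s s' -> neval base s' = neval base s) ->
  arr (run (rows_prog base rm aM ab th) s) 4 x y =
  if (neval base s <= x < neval base s + reg s rm)%N && (y < reg s 2)%N
  then arr s aM (x - neval base s)%N y * arr s th y 0%N
       / arr s ab (x - neval base s)%N 0%N
  else arr s 4 x y.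
Proof.
move=> haM hab hrm hth hb; set b := neval base s; move: x y.
apply: (run_for_inv (I := fun k s' => forall x y, arr s' 4 x y =
  if (b <= x < b + k)%N && (y < reg s 2)%N
  then arr s aM (x - b)%N y * arr s th y 0%N / arr s ab (x - b)%N 0%N
  else arr s 4 x y)) => [x y|j s' _ [fa fr] IH] /=.
  by case: ifP => //; lia.
set s0 := tick (set_reg 6 j s').
have E0 : reg s' 2 = reg s 2 by rewrite fr ?inE.
suff H x y : arr (run (For 5 (NReg 2)
    (RSet 4 (NAdd base (NReg 6)) (NReg 5)
       (RDiv (RMul (RGet aM (NReg 6) (NReg 5)) (entry th 5)) (entry ab 6)))) s0) 4 x y =
   if (x == b + j)%N && (y < reg s 2)%N
   then arr s aM j y * arr s th y 0%N / arr s ab j 0%N else arr s' 4 x y.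
  move=> x y; rewrite H IH; case: (ltnP y (reg s 2)) => [yn|_]; last by rewrite !andbF.
  rewrite !andbT; case: (x =P _) => [->|xi].
    by rewrite leq_addr addKn addnS ltnS leqnn.
  by case: ifP => h1; case: ifP => h2 //; lia.
rewrite -{1}E0; move: x y.
apply: (run_for_inv (I := fun k s'' => forall x y, arr s'' 4 x y =
  if (x == b + j)%N && (y < k)%N
  then arr s aM j y * arr s th y 0%N / arr s ab j 0%N
  else arr s' 4 x y)) => [x y|i s2 _ [fa2 fr2] IH2] /=.
  by rewrite andbF.
move=> x y.
have -> : reg s2 6 = j by rewrite fr2.
have -> : neval base (tick (set_reg 5 i s2)) = b.
  apply: hb; split=> z hz /=.
    by rewrite fa2 // fa.
  have /norP[z6 /norP[z5 _]] : ~~ [|| z == 6, z == 5 | false].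
    by move: hz; rewrite !inE orbF.
  by rewrite (negbTE z5) fr2 ?inE //= (negbTE z6) fr // !inE negb_or z6.
have -> : arr s2 aM = arr s aM by rewrite fa2 /= ?fa //; notin.
have -> : arr s2 th = arr s th by rewrite fa2 /= ?fa //; notin.
have -> : arr s2 ab = arr s ab by rewrite fa2 /= ?fa //; notin.
rewrite IH2 ltnS; case: (x =P _) => //= _.
by case: (ltngtP y i) => // ->.
Qed.

Lemma box_progE s x y : arr (run box_prog s) 4 x y =
  if (reg s 0 + reg s 1 <= x < reg s 0 + reg s 1 + reg s 2)%N &&
     (y == x - (reg s 0 + reg s 1))%N then 1 else arr s 4 x y.
Proof.
set b := (reg s 0 + reg s 1)%N; move: x y.
apply: (run_for_inv (I := fun k s' => forall x y, arr s' 4 x y =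
  if (b <= x < b + k)%N && (y == x - b)%N then 1 else arr s 4 x y))
  => [x y|j s' _ [fa fr] IH x y] /=.
  by case: ifP => //; lia.
rewrite !fr ?inE // -/b IH.
case: ifP => h1; first by case: ifP => //; lia.
by case: ifP => h2; case: ifP => h3 //; lia.
Qed.

Lemma ones_progE base rm s x y : (rm < 3)%N ->
  (forall s', frame [:: 5] [:: 6] s s' -> neval base s' = neval base s) ->
  arr (run (ones_prog base rm) s) 5 x y =
  if (neval base s <= x < neval base s + reg s rm)%N && (y == 0)%N then 1
  else arr s 5 x y.
Proof.
move=> hrm hb; rewrite (@run_map R (fun=> 1) 5 (neval base s)) //.
by move=> i s' _ fr ri x' y'; rewrite arr_rset /= ri hb.
Qed.

Lemma obj_progE s i : (i < reg s 2)%N ->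
  arr (run obj_prog s) 6 i 0%N = arr s 11 i 0%N * arr s 12 i 0%N.
Proof.
move=> hi; rewrite (@run_map R (fun i => arr s 11 i 0%N * arr s 12 i 0%N) 6 0).
  by rewrite /= add0n hi subn0.
move=> j s' _ [fa fr] rj x y.
by rewrite arr_rset /= rj add0n (fa 11) // (fa 12).
Qed.

Lemma copy_progE s i : (i < reg s 2)%N ->
  arr (run copy_prog s) 10 i 0%N = arr s 7 i 0%N.
Proof.
move=> hi; rewrite (@run_map R (fun i => arr s 7 i 0%N) 10 0).
  by rewrite /= add0n hi subn0.
by move=> j s' _ [fa fr] rj x y; rewrite arr_rset /= rj add0n (fa 7).
Qed.

Lemma output_progE th ld out s i : (out < 10)%N -> (10 < th)%N -> (10 < ld)%N ->
  (i < reg s 2)%N -> arr (run (output_prog th ld out) s) out i 0%N =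
  arr s th i 0%N * arr s 10 i 0%N / arr s ld 0%N 0%N.
Proof.
move=> ho ht hl hi; rewrite (@run_map R
  (fun i => arr s th i 0%N * arr s 10 i 0%N / arr s ld 0%N 0%N) out 0).
  by rewrite /= add0n hi subn0.
move=> j s' _ [fa fr] rj x y.
by rewrite arr_rset /= rj add0n !(fa th, fa 10, fa ld) //; notin.
Qed.

Lemma log_progP rm out s : (rm < 2)%N -> exists2 t : nat,
  log_approx (reg s rm) t & arr (run (log_prog rm out) s) out 0%N 0%N = t%:R.
Proof.
move=> hrm; rewrite /log_prog !run_seq.
move: (run (put out (RLit 1)) _) (frame_run (put out (RLit 1))
  (run (NSet 8 (NLit 2)) s)) (arr_put out (RLit 1) (run (NSet 8 (NLit 2)) s))
  => s1 [_ r1] a1.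
have r18 : reg s1 8 = 2%N by rewrite r1.
have r1m : reg s1 rm = reg s rm.
  by rewrite r1 //= /run /= ifF //; lia.
set m := reg s rm in r1m *.
set s2 := run (For _ _ _) s1.
(* Either the doubling has stopped, or every one of the [k] iterations doubled and [t = k + 1]. At
   [k = m] the second case also gives [m < 2 ^ t]. *)
have [t [u8 at' t0 tm [mu|tE]]] : exists t : nat,
    [/\ reg s2 8 = (2 ^ t)%N, arr s2 out 0%N 0%N = t%:R, (0 < t)%N,
        (2 ^ t.-1 <= maxn 1 m)%N & ((m < 2 ^ t)%N \/ t = m.+1)].
- rewrite -{3}r1m.
  apply: (run_for_inv (I := fun k s' => exists t : nat,
    [/\ reg s' 8 = (2 ^ t)%N, arr s' out 0%N 0%N = t%:R, (0 < t)%N,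
        (2 ^ t.-1 <= maxn 1 m)%N & ((m < 2 ^ t)%N \/ t = k.+1)])).
    by exists 1%N; split=> //=; [rewrite expn0; lia|right].
  move=> k s' _ [fa fr] [t [u8 at' t0 tm tk]]; rewrite run_if /=.
  have -> : (rm == 6)%N = false by lia.
  have -> : reg s' rm = m by rewrite fr ?r1m //; notin.
  rewrite u8; case: leqP => h.
    exists t.+1; rewrite run_seq arr_put; split.
    + by rewrite /run /= u8 expnS mul2n addnn.
    + by rewrite /run /= at' natr1.
    + by [].
    + by rewrite leq_max h orbT.
    + by case: tk => [|->]; [lia|right].
  by exists t; rewrite /run /=; split=> //; left.
- by exists t.
- exists t => //; split=> //; rewrite tE.
  by apply: ltn_trans (ltn_expl m (ltnSn 1)) _; rewrite ltn_exp2l.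
Qed.

Lemma linval_progE out s : (14 < out)%N ->
  arr (run (linval_prog out) s) out 0%N 0%N =
  linval (reg s 2) (fun i => arr s 6 i 0%N) (fun i => arr s 10 i 0%N).
Proof.
move=> ho; rewrite run_seq.
move: (run (put out (RLit 0)) s) (frame_run (put out (RLit 0)) s)
  (arr_put out (RLit 0) s) => s1 [a1 r1] v1.
rewrite (run_fold (g := fun i x => x + arr s 6 i 0%N * arr s 10 i 0%N)).
  by rewrite iteri_sum v1 /= add0r r1.
move=> i s' _ [fa fr] ri; rewrite arr_put /= ri.
by rewrite !(fa 6, fa 10, a1 6, a1 10) //; notin.
Qed.

Lemma penalty_progE base rm tc out s :
  (rm < 2)%N -> (14 < tc < 17)%N -> (16 < out)%N ->
  (forall s', frame [:: out; 14] [:: 6; 5] s s' ->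
     neval base s' = neval base s) ->
  arr (run (penalty_prog base rm tc out) s) out 0%N 0%N =
  penalty (reg s 2) (arr s tc 0%N 0%N) (reg s rm)
    (fun j i => arr s 4 (neval base s + j)%N i) (fun i => arr s 10 i 0%N).
Proof.
move=> hrm htc hout hb; rewrite run_seq.
move: (run (put out (RLit 1)) s) (frame_run (put out (RLit 1)) s)
  (arr_put out (RLit 1) s) => s1 [a1 r1] v1.
rewrite (run_fold (g := fun j x => x + \prod_(i < reg s 2)
   (1 + arr s tc 0%N 0%N * arr s 4 (neval base s + j)%N i * arr s 10 i 0%N))).
  by rewrite iteri_sum v1 /= !r1.
move=> j s2 _ [a2 r2] rj; rewrite !run_seq.
move: (run (put 14 (RLit 1)) s2) (frame_run (put 14 (RLit 1)) s2)
  (arr_put 14 (RLit 1) s2) => s3 [a3 r3] v3.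
set s4 := run (For _ _ _) s3.
have [a4 r4] : frame _ _ s3 s4 := frame_run _ _.
rewrite arr_put /= a4 ?a3 //; try notin; congr (_ + _).
rewrite /s4 (run_fold (g := fun i x => x * (1 + arr s tc 0%N 0%N *
   arr s 4 (neval base s + j)%N i * arr s 10 i 0%N))).
  by rewrite iteri_prod v3 /= mul1r r3 // r2 ?r1.
move=> i s5 _ [a5 r5] ri; rewrite arr_put /= ri.
have rj5 : reg s5 6 = j by rewrite r5 // r3.
have -> : neval base s5 = neval base s.
  apply: hb; split=> z; rewrite !inE => hz.
    by rewrite a5 ?a3 ?a2 ?a1 //; notin.
  by rewrite r5 ?r3 ?r2 ?r1 //; notin.
rewrite rj5 !(a5 tc, a5 4, a5 10, a3 tc, a3 4, a3 10, a2 tc, a2 4, a2 10,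
   a1 tc, a1 4, a1 10) //; notin.
Qed.

(** That [V] dominates all loads yields feasibility; that it is 1 or an actual load is what
    [load_le] asks for. *)
Lemma load_progP base rm out s : (rm < 2)%N -> (16 < out)%N ->
  (forall s', frame [:: out; 14] [:: 6; 5] s s' ->
     neval base s' = neval base s) ->
  let V := arr (run (load_prog base rm out) s) out 0%N 0%N in
  let ld j := \sum_(i < reg s 2) arr s 4 (neval base s + j)%N i * arr s 10 i 0%N in
  [/\ 1 <= V, forall j, (j < reg s rm)%N -> ld j <= V &
      V = 1 \/ (exists2 j, (j < reg s rm)%N & V = ld j)].
Proof.
move=> hrm hout hb /=.
set ld := fun j => \sum_(i < reg s 2) arr s 4 (neval base s + j)%N i * arr s 10 i 0%N.
rewrite run_seq.
move: (run (put out (RLit 1)) s) (frame_run (put out (RLit 1)) s)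
  (arr_put out (RLit 1) s) => s1 [a1 r1] v1.
rewrite (run_fold (g := fun j x => if ld j <= x then x else ld j)).
  rewrite v1 /= r1 //; elim: (reg s rm) => [|k [I1 I2 I3]] /=.
    by split=> //; left.
  move: I1 I2 I3; set x := iteri k _ _ => I1 I2 I3; case: (lerP (ld k) x) => h.
    split=> // [j|]; first by rewrite ltnS leq_eqVlt => /orP[/eqP->|/I2].
    by case: I3 => [|[j jk jE]]; [left|right; exists j => //; rewrite ltnW].
  split=> [|j|]; first exact: le_trans I1 (ltW h).
    rewrite ltnS leq_eqVlt => /orP[/eqP-> //|/I2 /le_trans]; apply.
    exact: ltW.
  by right; exists k.
move=> j s2 _ [a2 r2] rj; rewrite !run_seq run_if.
move: (run (put 14 (RLit 0)) s2) (frame_run (put 14 (RLit 0)) s2)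
  (arr_put 14 (RLit 0) s2) => s3 [a3 r3] v3.
set s4 := run (For _ _ _) s3.
have [a4 r4] : frame _ _ s3 s4 := frame_run _ _.
have v4 : arr s4 14 0%N 0%N = ld j.
  rewrite /s4 (run_fold (g := fun i x => x +
     arr s 4 (neval base s + j)%N i * arr s 10 i 0%N)).
    by rewrite iteri_sum v3 /= add0r r3 // r2 ?r1.
  move=> i s5 _ [a5 r5] ri; rewrite arr_put /= ri.
  have rj5 : reg s5 6 = j by rewrite r5 // r3.
  have -> : neval base s5 = neval base s.
    apply: hb; split=> z; rewrite !inE => hz.
      by rewrite a5 ?a3 ?a2 ?a1 //; notin.
    by rewrite r5 ?r3 ?r2 ?r1 //; notin.
  rewrite rj5 !(a5 4, a5 10, a3 4, a3 10, a2 4, a2 10, a1 4, a1 10) //; notin.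
have o4 : arr s4 out 0%N 0%N = arr s2 out 0%N 0%N.
  by rewrite a4 ?a3 //; notin.
rewrite /= v4 o4; case: ifP => _; last by rewrite arr_put.
by rewrite /run.
Qed.

End Specifications.

(** * The composed stages: potential, coordinate fixing, construction of the linear program *)

Section Stages.
Variable R : realType.
Implicit Type s : state R.

Lemma arr_frame c s a : a \notin warr c -> arr (run c s) a = arr s a.
Proof. exact: (frame_run c s).1. Qed.

Lemma reg_frame c s v : v \notin wreg c -> reg (run c s) v = reg s v.
Proof. exact: (frame_run c s).2. Qed.

Lemma neval_lit k s : neval (NLit k) s = k. Proof. by []. Qed.

Lemma neval_reg v s : neval (NReg v) s = reg s v. Proof. by []. Qed.

Lemma neval_add e1 e2 s :
  neval (NAdd e1 e2) s = (neval e1 s + neval e2 s)%N.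
Proof. by []. Qed.

Definition nevalE := (neval_lit, neval_reg, neval_add).

Definition vec10 s (i : nat) : R := arr s 10 i 0%N.

Definition obj_of s : (nat -> R) -> R := linval (reg s 2) (fun i => arr s 6 i 0%N).
Definition pen1_of s : (nat -> R) -> R :=
  penalty (reg s 2) (arr s 15 0%N 0%N) (reg s 0) (arr s 4).
Definition pen2_of s : (nat -> R) -> R :=
  penalty (reg s 2) (arr s 16 0%N 0%N) (reg s 1)
    (fun j i => arr s 4 (reg s 0 + j)%N i).
(** Only the rounded vector is left as argument; the parameters are read from cells that [fix_prog]
    does not write. *)
Definition pot_of s : (nat -> R) -> R :=
  potential (reg s 2) (arr s 15 0%N 0%N) (reg s 0) (arr s 4)
    (arr s 16 0%N 0%N) (reg s 1) (fun j i => arr s 4 (reg s 0 + j)%N i)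
    (fun i => arr s 6 i 0%N)
    (arr s 20 0%N 0%N) (arr s 21 0%N 0%N) (arr s 22 0%N 0%N).

Lemma values_progE o o1 o2 s : (16 < o)%N -> (16 < o1)%N -> (16 < o2)%N ->
  o != o1 -> o != o2 -> o1 != o2 ->
  let s' := run (values_prog o o1 o2) s in
  [/\ arr s' o 0%N 0%N = obj_of s (vec10 s),
      arr s' o1 0%N 0%N = pen1_of s (vec10 s) &
      arr s' o2 0%N 0%N = pen2_of s (vec10 s)].
Proof.
move=> h0 h1 h2 n01 n02 n12 /=; rewrite /values_prog 2!run_seq.
set s1 := run (linval_prog o) s.
have [a1 r1] : frame _ _ s s1 := frame_run _ _.
set s2 := run (penalty_prog (NLit 0) 0 15 o1) s1.
have [a2 r2] : frame _ _ s1 s2 := frame_run _ _.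
split.
- rewrite arr_frame; last notin.
  by rewrite a2 ?linval_progE //; notin.
- rewrite arr_frame; last notin.
  rewrite penalty_progE // /pen1_of /vec10 !r1 //.
  by rewrite !(a1 15, a1 4, a1 10) //; notin.
- rewrite penalty_progE //; last first.
    by move=> s' [_ fr] /=; rewrite fr.
  rewrite /pen2_of /vec10 /= !r2 // !r1 //.
  by rewrite !(a2 16, a2 4, a2 10, a1 16, a1 4, a1 10) //; notin.
Qed.

Lemma potential_progE out s : (22 < out)%N ->
  arr (run (potential_prog out) s) out 0%N 0%N = pot_of s (vec10 s).
Proof.
move=> ho; rewrite /potential_prog run_seq arr_put.
have [//|//|//|//|//|//|v0 v1 v2] := @values_progE 17 18 19 s.
rewrite /= v0 v1 v2 !arr_frame //.
Qed.

Lemma fix_progP s :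
  (forall i, (i < reg s 2)%N -> 0 <= vec10 s i <= 1) ->
  let s' := run fix_prog s in
  [/\ forall i, (i < reg s 2)%N -> 0 <= vec10 s' i <= 1,
      forall i, (i < reg s 2)%N -> vec10 s' i = 0 \/ vec10 s' i = 1 &
      pot_of s (vec10 s) <= pot_of s (vec10 s')].
Proof.
move=> v01 /=.
apply: (run_for_inv (I := fun k s' =>
  [/\ forall i, (i < reg s 2)%N -> 0 <= vec10 s' i <= 1,
      forall i, (i < k)%N -> vec10 s' i = 0 \/ vec10 s' i = 1 &
      pot_of s (vec10 s) <= pot_of s (vec10 s')]))
  => [//|k s' kn [fa fr] [IH1 IHi IH2]].
(* The potential stays the same function throughout the loop, so values from different iterations
   are comparable. *)
have pot0 t : frame (warr fix_prog) (wreg fix_prog) s t -> pot_of t = pot_of s.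
  case=> fa' fr'; rewrite /pot_of !(fr' 0%N, fr' 1%N, fr' 2%N) //.
  by rewrite !(fa' 4%N, fa' 6%N, fa' 15, fa' 16, fa' 20, fa' 21, fa' 22).
have set10 t e : reg t 7 = k ->
    vec10 (run (RSet 10 (NReg 7) (NLit 0) e) t) = upd (vec10 t) k (reval e t).
  by move=> t7; apply/funext => i; rewrite /vec10 arr_rset /= t7 andbT.
have upd_upd u r r' : upd (upd u k r') k r = upd u k r.
  by apply/funext => i; rewrite /upd; case: eqP.
have : frame (warr fix_prog) (wreg fix_prog) s (tick (set_reg 7 k s')).
  split=> x hx; first by rewrite /= fa.
  by rewrite /= ifF ?fr //; move: hx; notin.
have : reg (tick (set_reg 7 k s')) 7 = k by [].
move: (tick (set_reg 7 k s')) (erefl : vec10 (tick (set_reg 7 k s')) = vec10 s').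
move=> s0 v0 r0 f0; rewrite 4!run_seq run_if.
move: (run (RSet 10 (NReg 7) (NLit 0) (RLit 1)) s0)
  (frame_run (RSet 10 (NReg 7) (NLit 0) (RLit 1)) s0)
  (set10 s0 (RLit 1) r0) => s1 [a1 r1] v1.
move: (run (potential_prog 23) s1) (frame_run (potential_prog 23) s1)
  (potential_progE s1 (isT : 22 < 23)%N) => s2 [a2 r2] p2.
have v2 : vec10 s2 = upd (vec10 s') k 1 by rewrite -v0 -v1 /vec10 a2.
have r27 : reg s2 7 = k by rewrite r2 ?r1.
move: (run (RSet 10 (NReg 7) (NLit 0) (RLit 0)) s2)
  (frame_run (RSet 10 (NReg 7) (NLit 0) (RLit 0)) s2)
  (set10 s2 (RLit 0) r27) => s3 [a3 r3] v3.
move: (run (potential_prog 24) s3) (frame_run (potential_prog 24) s3)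
  (potential_progE s3 (isT : 22 < 24)%N) => s4 [a4 r4] p4.
have f1 : frame (warr fix_prog) (wreg fix_prog) s s1.
  case: f0 => a0 r0'; split=> x hx; first by rewrite a1 ?a0 //; move: hx; notin.
  by rewrite r1 ?r0'.
have f3 : frame (warr fix_prog) (wreg fix_prog) s s3.
  case: f1 => a1' r1'; split=> x hx.
    by rewrite a3 ?a2 ?a1' //; move: hx; notin.
  by rewrite r3 // r2 ?r1' //; move: hx; notin.
have v3' : vec10 s3 = upd (vec10 s') k 0 by rewrite v3 v2 upd_upd.
rewrite (pot0 _ f1) v1 v0 in p2; rewrite (pot0 _ f3) v3' in p4.
have q4 : arr s4 23 0%N 0%N = pot_of s (upd (vec10 s') k 1).
  by rewrite -p2 a4 ?a3.
have v4 : vec10 s4 = upd (vec10 s') k 0.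
  by rewrite -v3' /vec10 a4.
have r47 : reg s4 7 = k by rewrite r4 ?r3.
have upd01 r : 0 <= r <= 1 -> forall i, (i < reg s 2)%N ->
    0 <= upd (vec10 s') k r i <= 1.
  by move=> hr i hi; rewrite /upd; case: eqP => // _; exact: IH1.
have updi r : r = 0 \/ r = 1 -> forall i, (i < k.+1)%N ->
    upd (vec10 s') k r i = 0 \/ upd (vec10 s') k r i = 1.
  by move=> hr i hi; rewrite /upd; case: eqP => // ik; apply: IHi; lia.
have aff : affine_at (pot_of s) k by exact: potential_affine.
have := le_trans IH2 (affine_at_le aff (IH1 k kn)).
rewrite [beval _ _](_ : _ = (arr s4 24 0%N 0%N <= arr s4 23 0%N 0%N)) // p4 q4.
case: ifP => _ le; last first.
  rewrite [vec10 (run Skip _)](_ : _ = vec10 s4) // v4.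
  by split=> // i hi; [apply: upd01; rewrite ?lexx ?ler01|apply: updi; auto].
rewrite set10 // [vec10 (tick s4)](_ : _ = vec10 s4) // v4 upd_upd.
by split=> // i hi; [apply: upd01; rewrite ?lexx ?ler01|apply: updi; auto].
Qed.

Definition theta_of s := coord_bound (arr s 0) (arr s 1) (reg s 0).
Definition gamma_of s := coord_bound (arr s 2) (arr s 3) (reg s 1).

Lemma build_regs s : let s' := run build_prog s in
  [/\ reg s' 0 = reg s 0, reg s' 1 = reg s 1, reg s' 2 = reg s 2,
      reg s' 3 = (reg s 0 + reg s 1 + reg s 2)%N & reg s' 4 = reg s 2].
Proof.
move=> s'; split; try by rewrite /s' reg_frame.
  have E t : reg (run (Seq (NSet 3 (NAdd (NAdd (NReg 0) (NReg 1)) (NReg 2)))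
    (NSet 4 (NReg 2))) t) 3 = (reg t 0 + reg t 1 + reg t 2)%N by [].
  by rewrite /s' /build_prog 9!run_seq E !reg_frame.
have E t : reg (run (NSet 4 (NReg 2)) t) 4 = reg t 2 by [].
by rewrite /s' /build_prog 10!run_seq E !reg_frame.
Qed.

Lemma build_bounds s i : (i < reg s 2)%N -> let s' := run build_prog s in
  arr s' 11 i 0%N = theta_of s i /\ arr s' 12 i 0%N = gamma_of s i.
Proof.
move=> hi; rewrite /build_prog; split.
  by rewrite run_seq arr_frame // bound_progE.
rewrite 2!run_seq arr_frame // bound_progE //.
  by rewrite /gamma_of !arr_frame // reg_frame.
by rewrite reg_frame.
Qed.

Lemma build_obj s i : (i < reg s 2)%N ->
  arr (run build_prog s) 6 i 0%N = theta_of s i * gamma_of s i.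
Proof.
move=> hi; have [<- <-] := build_bounds hi.
rewrite /build_prog 9!run_seq arr_frame // obj_progE; last by rewrite !reg_frame.
by congr (_ * _); rewrite [in RHS]arr_frame // [in RHS]arr_frame.
Qed.

Lemma build_rhs s x : (x < reg s 0 + reg s 1 + reg s 2)%N ->
  arr (run build_prog s) 5 x 0%N = 1.
Proof.
move=> hx; rewrite /build_prog 10!run_seq !(arr_frame _ (a := 5) (c := NSet _ _)) //.
rewrite (arr_frame (c := obj_prog)) // ones_progE //; last first.
  by move=> s' [_ fr] /=; rewrite !fr.
rewrite ones_progE //; last by move=> s' [_ fr] /=; rewrite !fr.
rewrite ones_progE // !nevalE !reg_frame // !add0n.
by case: ifP => // h1; case: ifP => // h2; case: ifP => // h3; lia.
Qed.

(** The initial zeros of array 4 provide the off-diagonal entries of the box rows, of which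
    [box_prog] writes only the diagonal. *)
Lemma build_rows s x y : arr s 4 = (fun _ _ => 0) ->
  (x < reg s 0 + reg s 1 + reg s 2)%N -> (y < reg s 2)%N ->
  arr (run build_prog s) 4 x y =
  if (x < reg s 0)%N then arr s 0 x y * theta_of s y / arr s 1 x 0%N
  else if (x < reg s 0 + reg s 1)%N then
    arr s 2 (x - reg s 0)%N y * gamma_of s y / arr s 3 (x - reg s 0)%N 0%N
  else (y == x - (reg s 0 + reg s 1))%N%:R.
Proof.
move=> s4 hx hy; have [<- <-] := build_bounds hy.
have e11 : arr (run build_prog s) 11 =
    arr (run (bound_prog 2 3 1 12) (run (bound_prog 0 1 0 11) s)) 11.
  by rewrite /build_prog 2!run_seq arr_frame.
have e12 : arr (run build_prog s) 12 =
    arr (run (bound_prog 2 3 1 12) (run (bound_prog 0 1 0 11) s)) 12.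
  by rewrite /build_prog 2!run_seq arr_frame.
rewrite e11 e12 /build_prog 5!run_seq arr_frame //.
set t := run (bound_prog 2 3 1 12) _.
have ta a : a \notin [:: 11; 12; 13]%N -> arr t a = arr s a.
  move=> ha; rewrite !arr_frame //; first by move: ha; notin.
  by move: ha; notin.
have tr v : (v < 3)%N -> reg t v = reg s v.
  by move=> hv; rewrite !reg_frame //; notin.
rewrite box_progE !reg_frame // rows_progE //; last first.
  by move=> s' [_ fr] /=; rewrite !fr.
rewrite rows_progE // !nevalE !(reg_frame (c := rows_prog _ _ _ _ _)) //.
rewrite !(arr_frame (c := rows_prog _ _ _ _ _)) //.
rewrite !tr // !(ta 0%N, ta 1%N, ta 2%N, ta 3%N, ta 4%N) // s4 hy !subn0 !andbT.
case: (ltnP x (reg s 0)) => h1; [|case: (ltnP x (reg s 0 + reg s 1)) => h2].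
- by rewrite ifF //; lia.
- by [].
- by rewrite /= hx /=; case: eqP.
Qed.

End Stages.

(** * Correctness *)

Section Polytope.
Variables (R : realType) (M b : nat -> nat -> R) (m n : nat).
Hypothesis M0 : forall j i, 0 <= M j i.
Hypothesis b0 : forall j, 0 <= b j 0%N.

Local Notation theta := (coord_bound M b m).
Local Notation a j i := (M j i * theta i / b j 0%N).

Lemma coord_bound_ge0 i : 0 <= theta i.
Proof.
rewrite /coord_bound.
have: 0 <= \sum_(j < m) b j 0%N / M j i.
  by apply: sumr_ge0 => j _; rewrite divr_ge0.
move: (\sum_(_ < _) _) => x0 ge0; elim: m => [//|k IH] /=.
by case: ifP => // _; rewrite divr_ge0.
Qed.

(** Each update makes the violated constraint tight and lowers the value, which preserves the
    earlier constraints because [M >= 0]. *)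
Lemma coord_bound_feasible i j : (j < m)%N -> M j i * theta i <= b j 0%N.
Proof.
rewrite /coord_bound; move: (\sum_(_ < _) _) => x0; elim: m => // k IH.
rewrite ltnS leq_eqVlt /=.
set x := iteri k _ _ in IH *; case: (lerP (M k i * x) (b k 0%N)) => h.
  by case/orP=> [/eqP -> //|/IH].
have Mk : 0 < M k i.
  rewrite lt_def M0 andbT; apply: contraTneq h => ->.
  by rewrite mul0r ltNge b0.
case/orP=> [/eqP ->|/IH /(le_trans _)]; first by rewrite mulrCA divff ?mulr1 ?gt_eqF.
by apply; rewrite ler_wpM2l // ler_pdivrMr // mulrC ltW.
Qed.

(** [x] is below every ratio with a positive denominator. The positive entry puts such a ratio into
    the initial sum, and updates only assign such ratios. *)
Lemma le_coord_bound i x : (forall j, (j < m)%N -> M j i * x <= b j 0%N) ->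
  (exists2 j, (j < m)%N & 0 < M j i) -> x <= theta i.
Proof.
move=> xf [j jm Mj].
have le_ratio k : (k < m)%N -> 0 < M k i -> x <= b k 0%N / M k i.
  by move=> km Mk; rewrite ler_pdivlMr // mulrC xf.
have x_sum : x <= \sum_(j < m) b j 0%N / M j i.
  apply: le_trans (le_ratio j jm Mj) _.
  rewrite (bigD1 (Ordinal jm)) //= lerDl sumr_ge0 // => k _.
  by rewrite divr_ge0.
rewrite /coord_bound; move: (\sum_(_ < _) _) x_sum => x0 x_x0.
have: (m <= m)%N by []; elim: {1 3}m => [//|k IH km] /=.
set y := iteri k _ _ in IH *; case: (lerP (M k i * y) (b k 0%N)) => h.
  exact: IH (ltnW km).
apply: le_ratio => //; rewrite lt_def M0 andbT; apply: contraTneq h => ->.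
by rewrite mul0r ltNge b0.
Qed.

Lemma normalized_ge0_le1 j i : (j < m)%N -> 0 <= a j i <= 1.
Proof.
move=> jm; have h := coord_bound_feasible i jm.
rewrite divr_ge0 ?mulr_ge0 ?coord_bound_ge0 //=.
have [->|bj] := eqVneq (b j 0%N) 0; first by rewrite invr0 mulr0 ler01.
by rewrite ler_pdivrMr ?mul1r // lt_def bj b0.
Qed.

(** If [b_j = 0], feasibility forces the right-hand side to be 0 too. *)
Lemma normalizedK j i : (j < m)%N -> a j i * b j 0%N = M j i * theta i.
Proof.
move=> jm; have [bj|bj] := eqVneq (b j 0%N) 0; last by rewrite divfK.
have := coord_bound_feasible i jm; rewrite bj => h.
by rewrite mulr0; apply/eqP; rewrite eq_le h mulr_ge0 ?coord_bound_ge0.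
Qed.

Lemma scaled_feasible (v : nat -> R) V j : (j < m)%N -> 1 <= V ->
  \sum_(i < n) a j i * v i <= V ->
  \sum_(i < n) M j i * (theta i * v i / V) <= b j 0%N.
Proof.
move=> jm V1 vV; have V0 : 0 < V by rewrite (lt_le_trans ltr01).
have -> : \sum_(i < n) M j i * (theta i * v i / V) =
    b j 0%N * (\sum_(i < n) a j i * v i) / V.
  rewrite mulr_sumr mulr_suml; apply: eq_bigr => i _.
  transitivity (M j i * theta i * (v i / V)); first by ring.
  by move: (normalizedK i jm); move: (a j i) => y <-; ring.
by rewrite ler_pdivrMr // ler_wpM2l.
Qed.

Lemma normalized_relax (x u : nat -> R) j : (j < m)%N ->
  (forall i, (i < n)%N -> theta i * u i <= x i) ->
  \sum_(i < n) M j i * x i <= b j 0%N ->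
  \sum_(i < n) a j i * u i <= 1.
Proof.
move=> jm ux xb.
have -> : \sum_(i < n) a j i * u i = (\sum_(i < n) M j i * (theta i * u i)) / b j 0%N.
  rewrite mulr_suml; apply: eq_bigr => i _.
  by ring.
have [->|bj] := eqVneq (b j 0%N) 0; first by rewrite invr0 mulr0 ler01.
rewrite ler_pdivrMr ?mul1r; last by rewrite lt_def bj b0.
by apply: le_trans xb; apply: ler_sum => i _; rewrite ler_wpM2l // ux.
Qed.

End Polytope.

(** * Guarantees of the rounding program *)

Section RoundSpec.
Variables (R : realType) (s : state R).
Local Notation m1 := (reg s 0).
Local Notation m2 := (reg s 1).
Local Notation n := (reg s 2).
Local Notation A1 := (arr s 4).
Local Notation A2 := (fun j i => arr s 4 (m1 + j)%N i).
Local Notation c := (fun i => arr s 6 i 0%N).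
Local Notation w := (fun i => arr s 7 i 0%N).
Hypothesis A1b : forall j i, (j < m1)%N -> (i < n)%N -> 0 <= A1 j i <= 1.
Hypothesis A2b : forall j i, (j < m2)%N -> (i < n)%N -> 0 <= A2 j i <= 1.
Hypothesis c0 : forall i, (i < n)%N -> 0 <= c i.
Hypothesis wb : forall i, (i < n)%N -> 0 <= w i <= 1.
Hypothesis A1w : forall j, (j < m1)%N -> \sum_(i < n) A1 j i * w i <= 1.
Hypothesis A2w : forall j, (j < m2)%N -> \sum_(i < n) A2 j i * w i <= 1.

Lemma round_progP :
  exists (v : nat -> R) (V1 V2 : R),
    [/\ (forall i, (i < n)%N -> v i = 0 \/ v i = 1) /\ (1 <= V1 /\ 1 <= V2),
        (forall j, (j < m1)%N -> \sum_(i < n) A1 j i * v i <= V1) /\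
        (forall j, (j < m2)%N -> \sum_(i < n) A2 j i * v i <= V2),
        forall i, (i < n)%N -> arr (run round_prog s) 8 i 0%N =
          arr s 11 i 0%N * v i / V1,
        forall i, (i < n)%N -> arr (run round_prog s) 9 i 0%N =
          arr s 12 i 0%N * v i / V2 &
        4^-1 ^+ 5 * (loglog_over_log R m1 * loglog_over_log R m2)
          * linval n c w <= linval n c v / (V1 * V2)].
Proof.
rewrite /round_prog 8!run_seq.
have v1 i : (i < n)%N -> vec10 (run copy_prog s) i = w i.
  by move=> hi; rewrite /vec10 copy_progE.
move: (run copy_prog s) (frame_run copy_prog s) v1 => s1 [a1 r1] v1.
have := @log_progP R 0 15 s1 isT; rewrite r1 // => -[t1 lt1].
move: (run (log_prog 0 15) s1) (frame_run (log_prog 0 15) s1)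
  => s2 [a2 r2] e15.
have := @log_progP R 1 16 s2 isT; rewrite r2 // r1 // => -[t2 lt2].
move: (run (log_prog 1 16) s2) (frame_run (log_prog 1 16) s2)
  => s3 [a3 r3] e16.
have := @values_progE R 20 21 22 s3 isT isT isT isT isT isT.
move: (run (values_prog 20 21 22) s3) (frame_run (values_prog 20 21 22) s3)
  => s4 [a4 r4] /= [e20 e21 e22].
have vE : vec10 s4 = vec10 s1 by rewrite /vec10 a4 // a3 // a2.
have v3E : vec10 s3 = vec10 s4 by rewrite /vec10 a4.
have n4 : reg s4 2 = n by rewrite r4 // r3 // r2 // r1.
have m14 : reg s4 0 = m1 by rewrite r4 // r3 // r2 // r1.
have m24 : reg s4 1 = m2 by rewrite r4 // r3 // r2 // r1.
have e4 : arr s4 4 = arr s 4 by rewrite a4 // a3 // a2 // a1.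
have e6 : arr s4 6 = arr s 6 by rewrite a4 // a3 // a2 // a1.
have t15 : arr s4 15 0%N 0%N = t1%:R by rewrite a4 // a3.
have t16 : arr s4 16 0%N 0%N = t2%:R by rewrite a4.
have n3 : reg s3 2 = n by rewrite r3 // r2 // r1.
have m13 : reg s3 0 = m1 by rewrite r3 // r2 // r1.
have m23 : reg s3 1 = m2 by rewrite r3 // r2 // r1.
have wE i : (i < n)%N -> vec10 s4 i = w i by move=> hi; rewrite vE v1.
have := @fix_progP R s4; rewrite n4.
move: (run fix_prog s4) (frame_run fix_prog s4) => s5 [a5 r5] /= fixP.
have {fixP} [vb vi pot] := fixP (fun i hi =>
  eq_ind_r (fun x => 0 <= x <= 1) (wb hi) (wE i hi)).
have n5 : reg s5 2 = n by rewrite r5.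
have m15 : reg s5 0 = m1 by rewrite r5.
have m25 : reg s5 1 = m2 by rewrite r5.
have e45 : arr s5 4 = arr s 4 by rewrite a5.
have := @load_progP R (NLit 0) 0 25 s5 isT isT (fun _ _ => erefl).
move: (run (load_prog (NLit 0) 0 25) s5) (frame_run (load_prog (NLit 0) 0 25) s5)
  => s6 [a6 r6] /=; rewrite n5 m15 e45; set V1 := arr s6 25 _ _ => -[V1g V1l V1E].
have hb s' : frame [:: 26; 14] [:: 6; 5] s6 s' -> neval (NReg 0) s' = neval (NReg 0) s6.
  by case=> _ fr /=; rewrite fr.
have := @load_progP R (NReg 0) 1 26 s6 isT isT hb.
have n6 : reg s6 2 = n by rewrite r6.
have m16 : reg s6 0 = m1 by rewrite r6.
have m26 : reg s6 1 = m2 by rewrite r6.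
have e46 : arr s6 4 = arr s 4 by rewrite a6.
have v6 : arr s6 10 = arr s5 10 by rewrite a6.
move: (run (load_prog (NReg 0) 1 26) s6) (frame_run (load_prog (NReg 0) 1 26) s6)
  => s7 [a7 r7] /=; rewrite n6 m26 m16 e46 v6; set V2 := arr s7 26 _ _ => -[V2g V2l V2E].
have n7 : reg s7 2 = n by rewrite r7.
have v7 : arr s7 10 = arr s5 10 by rewrite a7.
have e11 : arr s7 11 = arr s 11.
  by rewrite a7 // a6 // a5 // a4 // a3 // a2 // a1.
have e12 : arr s7 12 = arr s 12.
  by rewrite a7 // a6 // a5 // a4 // a3 // a2 // a1.
have e25 : arr s7 25 0%N 0%N = V1 by rewrite a7.
exists (vec10 s5), V1, V2; split.
- by [].
- by split.
- move=> i hi; rewrite arr_frame // output_progE ?n7 //.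
  by rewrite e11 v7 e25.
- move=> i hi; rewrite output_progE //; last by rewrite reg_frame ?n7.
  by rewrite !(arr_frame (c := output_prog 11 25 8)) // e12 v7.
have -> : linval n c w = linval n c (vec10 s4).
  by apply: eq_bigr => i _; rewrite wE.
apply: (rounding_value lt1 lt2 A1b A2b c0 _ vb) => //.
- by move=> i hi; rewrite wE // wb.
- move=> j jm; rewrite (eq_bigr (fun i : 'I_n => A1 j i * w i)) ?A1w // => i _.
  by rewrite wE.
- move=> j jm; rewrite (eq_bigr (fun i : 'I_n => A2 j i * w i)) ?A2w // => i _.
  by rewrite wE.
(* Cells 20, 21, 22 hold the values at the fractional solution, so [pot] is the inequality wanted by
   [rounding_value]. *)
- move: pot; rewrite /pot_of n4 m14 m24 e4 e6 t15 t16 e20 e21 e22.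
  rewrite /obj_of /pen1_of /pen2_of n3 m13 m23 v3E.
  have -> : arr s3 4 = arr s 4 by rewrite a3 // a2 // a1.
  have -> : arr s3 6 = arr s 6 by rewrite a3 // a2 // a1.
  have -> : arr s3 15 0%N 0%N = t1%:R by rewrite a3.
  by rewrite e16.
- exact: lt_le_trans V1g.
- exact: lt_le_trans V2g.
Qed.

End RoundSpec.

(** * Matrices as memory arrays *)

Section Memory.
Variable R : realType.

Lemma mem_of_mxE m n (A : 'M[R]_(m, n)) (i : 'I_m) (j : 'I_n) :
  mem_of_mx A i j = A i j.
Proof. by rewrite /mem_of_mx !valK. Qed.

Lemma mem_of_mx_ge0 m n (A : 'M[R]_(m, n)) i j :
  nonneg_mx A -> 0 <= mem_of_mx A i j.
Proof. by move=> A0; rewrite /mem_of_mx; case: insub => // ?; case: insub. Qed.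

Lemma mem_mx_of_mem n (F : nat -> nat -> R) i :
  (i < n)%N -> mem_of_mx (mx_of_mem n 1 F) i 0%N = F i 0%N.
Proof.
move=> hi; have := mem_of_mxE (mx_of_mem n 1 F) (Ordinal hi) ord0.
by rewrite /= mxE.
Qed.

Lemma mx_of_memK m n (A : 'M[R]_(m, n)) : mx_of_mem m n (mem_of_mx A) = A.
Proof. by apply/matrixP => i j; rewrite mxE mem_of_mxE. Qed.

(** With entries indexed by natural numbers, the dimensions occur only as bounds, so [lp_rows] and
    [lp_vars] can be rewritten freely. *)
Lemma packing_memP k l (F G : nat -> nat -> R) (w : 'cV[R]_l) :
  packing (mx_of_mem k l F) (mx_of_mem k 1 G) w <->
  (forall i, (i < l)%N -> 0 <= mem_of_mx w i 0%N) /\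
  (forall j, (j < k)%N ->
     \sum_(i < l) F j i * mem_of_mx w i 0%N <= G j 0%N).
Proof.
have sumE (j : 'I_k) : (mx_of_mem k l F *m w) j 0 =
    \sum_(i < l) F j i * mem_of_mx w i 0%N.
  rewrite mxE; apply: eq_bigr => i _.
  by rewrite mxE -(mem_of_mxE w i ord0).
split=> -[w0 wF]; split=> [i hi|j hj].
- by have := w0 (Ordinal hi) ord0; rewrite -mem_of_mxE.
- by have := wF (Ordinal hj) ord0; rewrite sumE mxE.
- by rewrite -mem_of_mxE (ord1 hi) w0.
- by rewrite (ord1 hj) sumE mxE wF.
Qed.

Lemma dot_memE n (u v : 'cV[R]_n) :
  dot u v = \sum_(i < n) mem_of_mx u i 0%N * mem_of_mx v i 0%N.
Proof.
rewrite /dot mxE; apply: eq_bigr => i _.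
by rewrite mxE -(mem_of_mxE u i ord0) -(mem_of_mxE v i ord0).
Qed.

End Memory.

(** * The linear program relaxes the bilinear program *)

Section Relaxation.
Variables (R : realType) (m1 m2 n : nat).
Variables (P : 'M[R]_(m1, n)) (p : 'cV[R]_m1) (Q : 'M[R]_(m2, n)) (q : 'cV[R]_m2).
Hypotheses (P0 : nonneg_mx P) (p0 : nonneg_mx p).
Hypotheses (Q0 : nonneg_mx Q) (q0 : nonneg_mx q).

Local Notation theta := (coord_bound (mem_of_mx P) (mem_of_mx p) m1).
Local Notation gamma := (coord_bound (mem_of_mx Q) (mem_of_mx q) m2).

Lemma dot_sym (u v : 'cV[R]_n) : dot u v = dot v u.
Proof. by rewrite !dot_memE; apply: eq_bigr => i _; rewrite mulrC. Qed.

(* If column [i] of [M] vanishes, adding 1 to [x_i] preserves feasibility and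
   raises the objective by [y_i]. *)
Lemma zero_column k (M : 'M[R]_(k, n)) (b : 'cV[R]_k) (x y : 'cV[R]_n) (i : 'I_n) :
  packing M b x -> (forall x', packing M b x' -> dot x' y <= dot x y) ->
  0 < y i 0 -> exists2 j, (j < k)%N & 0 < mem_of_mx M j i.
Proof.
move=> [x0 xb] xmax yi; apply: contrapT => none.
have Mi j : M j i <= 0.
  rewrite leNgt; apply/negP => h; apply: none; exists j => //.
  by rewrite mem_of_mxE.
have /xmax : packing M b (x + delta_mx i 0).
  split=> j k'; first by rewrite !mxE addr_ge0 // ler0n.
  rewrite mulmxDr mxE -colE [X in _ + X]mxE; apply: le_trans (xb j k').
  by rewrite gerDl.
rewrite /dot linearD /= mulmxDl mxE trmx_delta -rowE [X in _ + X]mxE gerDl.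
by rewrite leNgt yi.
Qed.

Lemma coord_le_bound k (M : 'M[R]_(k, n)) (b : 'cV[R]_k) (x : 'cV[R]_n)
    (i : 'I_n) : nonneg_mx M -> nonneg_mx b -> packing M b x ->
  (exists2 j, (j < k)%N & 0 < mem_of_mx M j i) ->
  x i 0 <= coord_bound (mem_of_mx M) (mem_of_mx b) k i.
Proof.
move=> M0 b0 [x0 xb]; apply: le_coord_bound.
- by move=> *; exact: mem_of_mx_ge0.
- by move=> *; exact: mem_of_mx_ge0.
move=> j jk; have := xb (Ordinal jk) 0; rewrite mxE (bigD1 i) //=.
rewrite -(mem_of_mxE M) -(mem_of_mxE b) /=; apply: le_trans.
by rewrite lerDl sumr_ge0 // => l _; rewrite mulr_ge0.
Qed.

(** Optimality of [(x, y)] matters: where [x_i y_i > 0], [zero_column] excludes vanishing columns,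
    so [x_i <= theta_i] and [y_i <= gamma_i]. Elsewhere [u_i = 0]. *)
Lemma pdb_relaxation (z : R) : is_zPDB P p Q q z ->
  exists u : nat -> R,
    [/\ forall i, (i < n)%N -> 0 <= u i <= 1,
        forall j, (j < m1)%N -> \sum_(i < n)
          mem_of_mx P j i * theta i / mem_of_mx p j 0%N * u i <= 1,
        forall j, (j < m2)%N -> \sum_(i < n)
          mem_of_mx Q j i * gamma i / mem_of_mx q j 0%N * u i <= 1 &
        linval n (fun i => theta i * gamma i) u = z].
Proof.
move=> [[x [y [xP yQ ->]]] zmax].
pose X i := mem_of_mx x i 0%N; pose Y i := mem_of_mx y i 0%N.
pose u i := X i / theta i * (Y i / gamma i).
have uP i : (i < n)%N -> [/\ 0 <= u i <= 1, theta i * u i <= X i,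
    gamma i * u i <= Y i & theta i * gamma i * u i = X i * Y i].
  move=> hi; pose i' := Ordinal hi.
  have XE : X i = x i' 0 by rewrite -mem_of_mxE.
  have YE : Y i = y i' 0 by rewrite -mem_of_mxE.
  have Xi : 0 <= X i by rewrite XE; exact: xP.1.
  have Yi : 0 <= Y i by rewrite YE; exact: yQ.1.
  have [X0|Xn0] := eqVneq (X i) 0.
    by rewrite /u X0 !(mul0r, mulr0) lexx ler01.
  have [Y0|Yn0] := eqVneq (Y i) 0.
    by rewrite /u Y0 !(mul0r, mulr0) lexx ler01.
  have Xp : 0 < X i by rewrite lt_def Xn0.
  have Yp : 0 < Y i by rewrite lt_def Yn0.
  have Xt : X i <= theta i.
    rewrite XE; apply: (@coord_le_bound _ P p x i') => //.
    apply: (zero_column xP _ (_ : 0 < y i' 0)); last by rewrite -YE.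
    by move=> x' x'P; apply: zmax; exists x', y.
  have Yg : Y i <= gamma i.
    rewrite YE; apply: (@coord_le_bound _ Q q y i') => //.
    apply: (zero_column yQ _ (_ : 0 < x i' 0)); last by rewrite -XE.
    by move=> y' y'Q; rewrite dot_sym [leRHS]dot_sym; apply: zmax; exists x, y'.
  have tp := lt_le_trans Xp Xt; have gp := lt_le_trans Yp Yg.
  have a0 : 0 <= X i / theta i by rewrite divr_ge0 // ltW.
  have a1 : X i / theta i <= 1 by rewrite ler_pdivrMr ?mul1r.
  have b0 : 0 <= Y i / gamma i by rewrite divr_ge0 // ltW.
  have b1 : Y i / gamma i <= 1 by rewrite ler_pdivrMr ?mul1r.
  rewrite /u; split.
  - by rewrite mulr_ge0 //= mulr_ile1.
  - by rewrite mulrA [theta i * _]mulrC divfK ?gt_eqF // ler_piMr.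
  - by rewrite mulrCA [gamma i * _]mulrC divfK ?gt_eqF // ler_piMl.
  - by rewrite mulrACA [theta i * _]mulrC [gamma i * _]mulrC !divfK ?gt_eqF.
exists u; split.
- by move=> i /uP[].
- move=> j jm; apply: (@normalized_relax _ _ _ _ _ _ _ X) => //.
  + by move=> *; exact: mem_of_mx_ge0.
  + by move=> *; exact: mem_of_mx_ge0.
  + by move=> i /uP[].
  + have := xP; rewrite -{1}(mx_of_memK P) -{1}(mx_of_memK p).
    by move=> /packing_memP[_]; exact.
- move=> j jm; apply: (@normalized_relax _ _ _ _ _ _ _ Y) => //.
  + by move=> *; exact: mem_of_mx_ge0.
  + by move=> *; exact: mem_of_mx_ge0.
  + by move=> i /uP[].
  + have := yQ; rewrite -{1}(mx_of_memK Q) -{1}(mx_of_memK q).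
    by move=> /packing_memP[_]; exact.
- rewrite dot_memE; apply: eq_bigr => i _.
  by have [_ _ _ ->] := uP i (ltn_ord i).
Qed.

End Relaxation.

(** * The algorithm on a fixed instance *)

Section Instance.
Variables (R : realType) (m1 m2 n : nat).
Variables (P : 'M[R]_(m1, n)) (p : 'cV[R]_m1) (Q : 'M[R]_(m2, n)) (q : 'cV[R]_m2).
Hypotheses (P0 : nonneg_mx P) (p0 : nonneg_mx p).
Hypotheses (Q0 : nonneg_mx Q) (q0 : nonneg_mx q).

Local Notation theta := (coord_bound (mem_of_mx P) (mem_of_mx p) m1).
Local Notation gamma := (coord_bound (mem_of_mx Q) (mem_of_mx q) m2).
Local Notation a1 j i := (mem_of_mx P j i * theta i / mem_of_mx p j 0%N).
Local Notation a2 j i := (mem_of_mx Q j i * gamma i / mem_of_mx q j 0%N).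
Local Notation s0 := (input_state P p Q q).
Local Notation s := (run build_prog s0).

Lemma lp_rowsE : lp_rows s = (m1 + m2 + n)%N.
Proof. by have [] := build_regs s0. Qed.

Lemma lp_varsE : lp_vars s = n.
Proof. by have [] := build_regs s0. Qed.

Lemma lp_entryE x y : (x < m1 + m2 + n)%N -> (y < n)%N -> arr s 4 x y =
  if (x < m1)%N then a1 x y else
  if (x < m1 + m2)%N then a2 (x - m1)%N y else (y == x - (m1 + m2))%N%:R.
Proof. exact: (@build_rows R s0). Qed.

Lemma lp_packingP (w : 'cV[R]_(lp_vars s)) :
  packing (lp_A s) (lp_b s) w <->
  [/\ forall i, (i < n)%N -> 0 <= mem_of_mx w i 0%N <= 1,
      forall j, (j < m1)%N -> \sum_(i < n) a1 j i * mem_of_mx w i 0%N <= 1 &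
      forall j, (j < m2)%N -> \sum_(i < n) a2 j i * mem_of_mx w i 0%N <= 1].
Proof.
have [E1 E2] := @packing_memP R (lp_rows s) (lp_vars s) (arr s 4) (arr s 5) w.
move: (mem_of_mx w) E1 E2 => W E1 E2.
apply: (iff_trans (conj E1 E2)) => {E1 E2}; rewrite lp_rowsE lp_varsE.
have rhs x : (x < m1 + m2 + n)%N -> arr s 5 x 0%N = 1 by exact: (@build_rhs R s0).
have row1 j : (j < m1)%N -> \sum_(i < n) arr s 4 j i * W i 0%N =
    \sum_(i < n) a1 j i * W i 0%N.
  by move=> jm; apply: eq_bigr => i _; rewrite lp_entryE ?jm //; lia.
have row2 j : (j < m2)%N -> \sum_(i < n) arr s 4 (m1 + j)%N i * W i 0%N =
    \sum_(i < n) a2 j i * W i 0%N.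
  move=> jm; apply: eq_bigr => i _; rewrite lp_entryE //; last by lia.
  by rewrite ifF ?ifT ?addKn //; lia.
have row3 k : (k < n)%N -> \sum_(i < n) arr s 4 (m1 + m2 + k)%N i * W i 0%N = W k 0%N.
  move=> kn; rewrite (bigD1 (Ordinal kn)) //= big1 ?addr0 => [|i ik].
    rewrite lp_entryE //; last by lia.
    by rewrite !ifF ?addKn ?eqxx ?mul1r //; lia.
  rewrite lp_entryE //; last by lia.
  rewrite !ifF ?addKn; try lia.
  by move: ik; rewrite -val_eqE /= => /negbTE ->; rewrite mul0r.
split=> [[W0 WA]|[W01 W1 W2]].
  split=> [i hi|j jm|j jm].
  - by rewrite W0 //= -row3 // -(rhs (m1 + m2 + i)%N) ?WA //; lia.
  - by rewrite -row1 // -(rhs j) ?WA //; lia.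
  - by rewrite -row2 // -(rhs (m1 + j)%N) ?WA //; lia.
split=> [i /W01 /andP[] //|x hx]; rewrite rhs //.
have [x1|x1] := ltnP x m1; first by rewrite row1 ?W1.
have [x2|x2] := ltnP x (m1 + m2).
  by rewrite -(subnKC x1) row2 ?W2 //; lia.
by rewrite -(subnKC x2) row3; [have /andP[] := W01 (x - (m1 + m2))%N ltac:(lia)|lia].
Qed.

Lemma lp_dotE (w : 'cV[R]_(lp_vars s)) : dot (lp_c s) w =
  linval n (fun i => theta i * gamma i) (fun i => mem_of_mx w i 0%N).
Proof.
rewrite dot_memE.
have -> : \sum_(i < lp_vars s) mem_of_mx (lp_c s) i 0%N * mem_of_mx w i 0%N =
    \sum_(i < lp_vars s) arr s 6 i 0%N * mem_of_mx w i 0%N.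
  by apply: eq_bigr => i _; rewrite mem_mx_of_mem.
move: (mem_of_mx w) => W; rewrite lp_varsE; apply: eq_bigr => i _.
by rewrite (@build_obj R s0).
Qed.

Lemma lp_solvable : exists w, lp_optimal (lp_A s) (lp_b s) (lp_c s) w.
Proof.
apply: bounded_lp_solvable => [j k|w /lp_packingP[w01 _ _] i].
  have jr : (j < m1 + m2 + n)%N by rewrite -[X in (_ < X)%N]lp_rowsE.
  by rewrite mxE (ord1 k) (@build_rhs R s0) ?ler01.
have /w01/andP[_] : (i < n)%N by rewrite -[X in (_ < X)%N]lp_varsE.
by rewrite -(mem_of_mxE w i ord0).
Qed.

Lemma lp_value_ge (z : R) w : is_zPDB P p Q q z ->
  lp_optimal (lp_A s) (lp_b s) (lp_c s) w -> z <= dot (lp_c s) w.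
Proof.
move=> /pdb_relaxation[] // u [u01 u1 u2 uz] [_ wmax].
pose w' := mx_of_mem (lp_vars s) 1 (fun i _ => u i).
have w'E i : (i < n)%N -> mem_of_mx w' i 0%N = u i.
  by move=> hi; rewrite mem_mx_of_mem // lp_varsE.
have -> : z = dot (lp_c s) w'.
  by rewrite lp_dotE -uz; apply: eq_bigr => i _; rewrite w'E.
apply: wmax; apply/lp_packingP; split=> [i hi|j jm|j jm].
- by rewrite w'E ?u01.
- by rewrite (eq_bigr (fun i : 'I_n => a1 j i * u i)) ?u1 // => i _; rewrite w'E.
- by rewrite (eq_bigr (fun i : 'I_n => a2 j i * u i)) ?u2 // => i _; rewrite w'E.
Qed.

Lemma round_correct (w : 'cV[R]_(lp_vars s)) : packing (lp_A s) (lp_b s) w ->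
  let s' := run round_prog (return_solution w) in
  [/\ packing P p (out_x n s'), packing Q q (out_y n s') &
      4^-1 ^+ 5 * (loglog_over_log R m1 * loglog_over_log R m2)
        * dot (lp_c s) w <= dot (out_x n s') (out_y n s')].
Proof.
move=> /lp_packingP[w01 w1 w2] s'.
have Pg j i : 0 <= mem_of_mx P j i by exact: mem_of_mx_ge0.
have pg j : 0 <= mem_of_mx p j 0%N by exact: mem_of_mx_ge0.
have Qg j i : 0 <= mem_of_mx Q j i by exact: mem_of_mx_ge0.
have qg j : 0 <= mem_of_mx q j 0%N by exact: mem_of_mx_ge0.
have [r0 r1 r2 _ _] := build_regs s0.
have A1E j i : (j < m1)%N -> (i < n)%N -> arr s 4 j i = a1 j i.
  by move=> jm hi; rewrite lp_entryE ?jm //; lia.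
have A2E j i : (j < m2)%N -> (i < n)%N -> arr s 4 (m1 + j)%N i = a2 j i.
  move=> jm hi; rewrite lp_entryE //; last by lia.
  by rewrite ifF ?ifT ?addKn //; lia.
have cE i : (i < n)%N -> arr s 6 i 0%N = theta i * gamma i.
  exact: (@build_obj R s0).
have := @round_progP R (return_solution w).
rewrite [reg _ 0]r0 [reg _ 1]r1 [reg _ 2]r2.
rewrite [arr _ 4](_ : _ = arr s 4) // [arr _ 6](_ : _ = arr s 6) //.
rewrite [arr _ 7](_ : _ = mem_of_mx w) //.
rewrite [arr (return_solution w) 11](_ : _ = arr s 11) //.
rewrite [arr (return_solution w) 12](_ : _ = arr s 12) //.
case.
- by move=> j i jm hi; rewrite A1E //; exact: normalized_ge0_le1.
- by move=> j i jm hi; rewrite A2E //; exact: normalized_ge0_le1.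
- by move=> i hi; rewrite cE // mulr_ge0 ?coord_bound_ge0.
- exact: w01.
- move=> j jm; rewrite (eq_bigr (fun i : 'I_n => a1 j i * mem_of_mx w i 0%N)) ?w1 //.
  by move=> i _; rewrite A1E.
- move=> j jm; rewrite (eq_bigr (fun i : 'I_n => a2 j i * mem_of_mx w i 0%N)) ?w2 //.
  by move=> i _; rewrite A2E.
move=> v [V1 [V2 [[vi [V1g V2g]] [l1 l2] x8 y9 val]]].
have v0 i : (i < n)%N -> 0 <= v i by move=> /vi[]->; rewrite ?lexx ?ler01.
have V1p : 0 < V1 by exact: lt_le_trans V1g.
have V2p : 0 < V2 by exact: lt_le_trans V2g.
have bE i : (i < n)%N -> arr s 11 i 0%N = theta i /\ arr s 12 i 0%N = gamma i.
  exact: (@build_bounds R s0).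
have xE i : (i < n)%N -> mem_of_mx (out_x n s') i 0%N = theta i * v i / V1.
  by move=> hi; rewrite mem_mx_of_mem // x8 // (bE i hi).1.
have yE i : (i < n)%N -> mem_of_mx (out_y n s') i 0%N = gamma i * v i / V2.
  by move=> hi; rewrite mem_mx_of_mem // y9 // (bE i hi).2.
split.
- rewrite -(mx_of_memK P) -(mx_of_memK p); apply/packing_memP; split=> [i hi|j jm].
    by rewrite xE // divr_ge0 ?(ltW V1p) // mulr_ge0 ?v0 ?coord_bound_ge0.
  rewrite (eq_bigr (fun i : 'I_n => mem_of_mx P j i * (theta i * v i / V1))).
    apply: scaled_feasible => //; apply: le_trans (l1 j jm).
    by apply: ler_sum => i _; rewrite A1E.
  by move=> i _; rewrite xE.
- rewrite -(mx_of_memK Q) -(mx_of_memK q); apply/packing_memP; split=> [i hi|j jm].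
    by rewrite yE // divr_ge0 ?(ltW V2p) // mulr_ge0 ?v0 ?coord_bound_ge0.
  rewrite (eq_bigr (fun i : 'I_n => mem_of_mx Q j i * (gamma i * v i / V2))).
    apply: scaled_feasible => //; apply: le_trans (l2 j jm).
    by apply: ler_sum => i _; rewrite A2E.
  by move=> i _; rewrite yE.
- rewrite lp_dotE dot_memE.
  have -> : linval n (fun i => theta i * gamma i) (fun i => mem_of_mx w i 0%N) =
      linval n (fun i => arr s 6 i 0%N) (fun i => mem_of_mx w i 0%N).
    by apply: eq_bigr => i _; rewrite cE.
  apply: (le_trans val); rewrite /linval mulr_suml; apply: ler_sum => i _.
  rewrite cE // xE // yE // invfM.
  (* Integrality enters here: [v_i ^ 2 = v_i], so the bilinear objective becomes the linear one. *)
  by case: (vi i (ltn_ord i)) => ->; rewrite ?(mulr0, mul0r) ?mulr1 // mulrACA.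
Qed.

Lemma total_time (w : 'cV[R]_(lp_vars s)) :
  (steps (run round_prog (return_solution w)) <=
   (m1 + m2 + n).+2 ^ (tdeg build_prog + tdeg round_prog + 3))%N.
Proof.
have [r0 r1 r2 _ _] := build_regs s0.
have d0 : dims_below (m1 + m2 + n) s0.
  by case=> [|[|[|]]] //= _; lia.
have d1 : dims_below (m1 + m2 + n) (return_solution w).
  have e v : reg (return_solution w) v = reg s v by [].
  by case=> [|[|[|]]] // _; rewrite e ?r0 ?r1 ?r2 /=; lia.
have T1 := @run_time R build_prog (m1 + m2 + n) s0 isT isT isT d0.
have T2 := @run_time R round_prog (m1 + m2 + n) (return_solution w) isT isT isT d1.
apply: leq_trans T2 _.
have -> : steps (return_solution w) =
    (steps s + (lp_rows s).+1 * (lp_vars s).+1)%N by [].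
rewrite lp_rowsE lp_varsE.
move: T1; rewrite [steps s0](_ : _ = 0%N) // add0n; move: (steps s) => T T1.
have b1 : (0 < tdeg build_prog)%N by [].
have b2 : (0 < tdeg round_prog)%N by [].
move: (tdeg build_prog) (tdeg round_prog) T1 b1 b2 => d e T1 b1 b2.
set X := (m1 + m2 + n).+2 in T1 *.
have Xd : (0 < X ^ d)%N by rewrite expn_gt0.
have Xe : (0 < X ^ e)%N by rewrite expn_gt0.
have h : ((m1 + m2 + n).+1 * n.+1 <= X * X)%N by apply: leq_mul; lia.
rewrite !expnD !expnS expn0 muln1.
have X2 : (2 <= X)%N by [].
(* The summands pay for building, the solver call and rounding. *)
have : (X ^ d + X * X + X ^ e <= X ^ d * X ^ e * (X * (X * X)))%N.
  have : (X * X <= X ^ d * X ^ e * (X * X))%N by rewrite leq_pmull // muln_gt0 Xd.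
  have : (X ^ d <= X ^ d * X ^ e)%N by rewrite leq_pmulr.
  have : (X ^ e <= X ^ d * X ^ e)%N by rewrite leq_pmull.
  move: (X ^ d * X ^ e)%N (X ^ d)%N (X ^ e)%N => y yd ye h1 h2 h3.
  have h4 : (y * (X * X) * 2 <= y * (X * (X * X)))%N by rewrite -mulnA leq_mul2l; nia.
  have h5 : (y * 2 <= y * (X * X))%N by rewrite leq_mul2l; nia.
  by lia.
by lia.
Qed.

End Instance.

Theorem theorem1 (R : realType) :
  exists (alg : lp_rounding_alg) (C : R) (d : nat),
    0 < C /\
    forall (m1 m2 n : nat) (P : 'M[R]_(m1, n)) (p : 'cV[R]_m1)
           (Q : 'M[R]_(m2, n)) (q : 'cV[R]_m2) (z : R),
      nonneg_mx P -> nonneg_mx p -> nonneg_mx Q -> nonneg_mx q ->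
      is_zPDB P p Q q z ->
      lp_rounding_approx alg P p Q q z
        (C * (loglog_over_log R m1 * loglog_over_log R m2))
        ((m1 + m2 + n).+2 ^ d).
Proof.
exists (LPRoundingAlg build_prog round_prog), (4^-1 ^+ 5).
exists (tdeg build_prog + tdeg round_prog + 3)%N.
split; first by rewrite exprn_gt0 // invr_gt0.
move=> m1 m2 n P p Q q z P0 p0 Q0 q0 zP.
exists (run build_prog (input_state P p Q q)); split.
- exact: exec_run.
- exact: lp_solvable.
move=> w wopt D.
(* Neither program flips a coin, so all three events have probability 1. *)
have -> : D = dret R (run round_prog (return_solution w)) by exact: exec_run.
have zw := lp_value_ge P0 p0 Q0 q0 zP wopt.
have [fx fy val] := round_correct P0 p0 Q0 q0 wopt.1.
split=> //.
- exact: pr_dret.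
- by apply: pr_dret; exact: total_time.
- rewrite pr_dret; first by rewrite invf_le1 // ler1n.
  (* The guarantee is relative to the value of the linear program, which is at least [z]. *)
  apply: le_trans val; apply: ler_wpM2l => //.
  by rewrite mulr_ge0 ?exprn_ge0 ?invr_ge0 // mulr_ge0 // loglog_over_log_ge0.
Qed.
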